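(* Let $A=(a_{i,j})_{1\le i<j\le n}$ be a collection of integers such that all of the following inequalities hold strictly: (a) $a_{i,i+1}+a_{i+1,i+2}<a_{i,i+2}$ for $1\le i\le n-2$ and (b) $a_{i,j}+a_{i+1,j+1}<a_{i,j+1}+a_{i+1,j}$ for $1\le i<j-1\le n-2$. Let $S=\sigma(A)$ and let $\lambda=(a_1,\dots,a_{n-1})$ be a regular integral dominant weight (all $a_k>0$). Then the Gröbner degeneration $F^S$ of the complete flag variety is the toric variety associated with the polytope $P_\lambda$. This is isomorphic to the toric variety associated with the Gelfand–Tsetlin polytope $GT_\lambda$.
   Context: Fix $n\ge2$. Weights of $\mathfrak{sl}_n(\mathbb C)$ are written $(a_1,\dots,a_{n-1})=\sum a_k\omega_k$ with $\omega_k$ the fundamental weights. $R=\mathbb C[\{X_{i_1,\dots,i_k}\mid 1\le k\le n-1,\ 1\le i_1<\dots<i_k\le n\}]$ is the homogeneous coordinate ring of $\mathbb P=\prod_{k=1}^{n-1}\mathbb P(\wedge^k\mathbb C^n)$ (Plücker coordinates). $F=SL_n(\mathbb C)/B\subset\mathbb P$ is the variety of complete flags in its Plücker embedding and $I\subset R$ is its ideal of Plücker relations. For integers $S=(s_{i_1,\dots,i_k})$, $\mathrm{grad}^S$ is the grading on $R$ with $\mathrm{grad}^SX_{i_1,\dots,i_k}=s_{i_1,\dots,i_k}$, $\mathrm{in}_{\mathrm{grad}^S}I$ is the ideal spanned by the nonzero components of minimal grading of elements of $I$, and $F^S\subset\mathbb P$ is the subvariety defined by $\mathrm{in}_{\mathrm{grad}^S}I$.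 $\Theta=\mathbb R^{\{1\le i<j\le n\}}$. $T(i_1,\dots,i_k)\in\Theta$ has coordinate $1$ at each pair $(l,i_l)$ with $1\le l\le k$, $i_l>l$, and all other coordinates $0$. $\sigma(A)_{i_1,\dots,i_k}=\sum_{i<j}a_{i,j}T(i_1,\dots,i_k)_{i,j}$. $P_\lambda\subset\Theta$ is the convex lattice polytope of points $T$ with $T_{i,j}\ge0$ for all $1\le i<j\le n$ and $\sum_{l=j}^nT_{i,l}-\sum_{l=j+1}^nT_{i+1,l}\le a_i$ for all $1\le i<j\le n$ (the second sum is empty if $j=n$). $GT_\lambda\subset\Theta$ is the polytope of points $T$ with $\lambda_i\ge T_{i,i+1}\ge\lambda_{i+1}$ for $1\le i\le n-1$, where $\lambda_i=a_i+\dots+a_{n-1}$ and $\lambda_n=0$, and $T_{i,j-1}\ge T_{i,j}\ge T_{i+1,j}$ for all $1\le i<j\le n$ with $j>i+1$. *)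

(* Defs.v *)
From HB Require Import structures.
From mathcomp Require Import all_boot all_order all_algebra finmap.
From mathcomp Require Import reals complex mpoly.

Set Implicit Arguments.
Unset Strict Implicit.
Unset Printing Implicit Defensive.

Import Order.TTheory GRing.Theory Num.Theory.

Local Open Scope ring_scope.

(** * Products of projective spaces *)

(* The homogeneous coordinates are indexed by [coord]; those mapped to [d] by
   [fac] are the coordinates on the factor [d]. *)
Record multiproj := MultiProj
  { coord : finType; factor : finType; fac : coord -> factor }.

(* [mpoly] numbers its variables: coordinate [v] is variable [enum_rank v]. *)
Definition coord_ring (C : fieldType) (P : multiproj) : Type :=
  {mpoly C[#|coord P|]}.

Definition evalp (C : fieldType) (P : multiproj) (p : coord_ring C P)
    (x : coord P -> C) : C :=
  p.@[fun i => x (enum_val i)].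

(* Points are given by homogeneous coordinates, up to [same_point]. *)
Definition is_point (C : fieldType) (P : multiproj) (x : coord P -> C) : Prop :=
  forall d : factor P, exists v : coord P, fac v = d /\ x v != 0.

Definition same_point (C : fieldType) (P : multiproj) (x y : coord P -> C) :
    Prop :=
  exists t : factor P -> C,
    (forall d, t d != 0) /\ (forall v, y v = t (fac v) * x v).

(* The zero polynomial has every multidegree. *)
Definition has_multidegree (C : fieldType) (P : multiproj)
    (delta : factor P -> nat) (p : coord_ring C P) : Prop :=
  forall m, m \in msupp p ->
  forall d, (\sum_(v : coord P | fac v == d) m (enum_rank v))%N = delta d.

Definition multihomogeneous (C : fieldType) (P : multiproj)
    (p : coord_ring C P) : Prop :=
  exists delta, has_multidegree delta p.

Definition ideal_gen (C : fieldType) (P : multiproj)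
    (G : coord_ring C P -> Prop) (p : coord_ring C P) : Prop :=
  exists s : seq (coord_ring C P * coord_ring C P),
    (forall cg, cg \in s -> G cg.2) /\
    (p = \sum_(cg <- s) (cg.1 : {mpoly C[#|coord P|]}) * cg.2).

(* [X] may list just one representative of each of its points: whether a
   multihomogeneous polynomial vanishes does not depend on it. *)
Definition vanishing_ideal (C : fieldType) (P : multiproj)
    (X : (coord P -> C) -> Prop) : coord_ring C P -> Prop :=
  ideal_gen (fun p => multihomogeneous p /\ forall x, X x -> evalp p x = 0).

Definition zero_locus (C : fieldType) (P : multiproj)
    (J : coord_ring C P -> Prop) (x : coord P -> C) : Prop :=
  is_point x /\ forall p, J p -> evalp p x = 0.

Definition zariski_closure (C : fieldType) (P : multiproj)
    (X : (coord P -> C) -> Prop) : (coord P -> C) -> Prop :=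
  zero_locus (vanishing_ideal X).

(** * Isomorphisms of varieties *)

(* Around each point of [X] the map is given, in homogeneous coordinates, by
   multihomogeneous polynomials [g w] whose multidegree depends only on the
   factor of the target; the neighbourhood is the basic open set [h != 0].
   For a set [X] of the form [zero_locus J] with [J] multihomogeneous this
   forces [phi] to be well defined on points. *)
Definition regular_map (C : fieldType) (P Q : multiproj)
    (X : (coord P -> C) -> Prop) (Y : (coord Q -> C) -> Prop)
    (phi : (coord P -> C) -> (coord Q -> C)) : Prop :=
  (forall x, X x -> Y (phi x)) /\
  forall x, X x ->
  exists (h : coord_ring C P) (g : coord Q -> coord_ring C P)
         (e : factor Q -> factor P -> nat),
    [/\ multihomogeneous h, evalp h x != 0,
        forall w, has_multidegree (e (fac w)) (g w) &
        forall y, X y -> evalp h y != 0 ->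
          is_point (fun w => evalp (g w) y) /\
          same_point (fun w => evalp (g w) y) (phi y)].

Definition isomorphic (C : fieldType) (P Q : multiproj)
    (X : (coord P -> C) -> Prop) (Y : (coord Q -> C) -> Prop) : Prop :=
  exists (phi : (coord P -> C) -> (coord Q -> C))
         (psi : (coord Q -> C) -> (coord P -> C)),
    [/\ regular_map X Y phi, regular_map Y X psi,
        forall x, X x -> same_point x (psi (phi x)) &
        forall y, Y y -> same_point y (phi (psi y))].

(* The closed subscheme defined by the multihomogeneous ideal [J] has no
   nilpotents: at each of its points, [J] and the vanishing ideal of its zero
   locus have the same localization. *)
Definition reduced_subscheme (C : fieldType) (P : multiproj)
    (J : coord_ring C P -> Prop) : Prop :=
  forall (f : coord_ring C P) (x : coord P -> C),
    multihomogeneous f ->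
    (forall y, zero_locus J y -> evalp f y = 0) ->
    zero_locus J x ->
    exists h : coord_ring C P,
      [/\ multihomogeneous h, evalp h x != 0 &
          J ((h : {mpoly C[#|coord P|]}) * f)].

(* A scheme isomorphic to a variety is reduced, so this says that the closed
   subscheme defined by [J] is isomorphic to the variety [Y]. *)
Definition subscheme_isomorphic_to (C : fieldType) (P Q : multiproj)
    (J : coord_ring C P -> Prop) (Y : (coord Q -> C) -> Prop) : Prop :=
  reduced_subscheme J /\ isomorphic (zero_locus J) Y.

(** * The toric variety of a lattice polytope *)

Definition real_point (R : realType) (I : finType) (m : {ffun I -> int}) :
    {ffun I -> R} :=
  [ffun i => (m i)%:~R].

Definition dilate (R : realType) (I : finType) (k : nat)
    (Q : {ffun I -> R} -> Prop) (T : {ffun I -> R}) : Prop :=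
  exists2 T', Q T' & T = T' *+ k.

Definition lattice_points (R : realType) (I : finType)
    (Q : {ffun I -> R} -> Prop) (M : {fset {ffun I -> int}}) : Prop :=
  forall m, (m \in M) <-> Q (real_point R m).

Definition vertex (R : realType) (I : finType) (Q : {ffun I -> R} -> Prop)
    (v : {ffun I -> R}) : Prop :=
  Q v /\ forall x y, Q x -> Q y -> x + y = v *+ 2 -> x = v.

(* [u] is in the semigroup generated by [M - v]. *)
Definition in_semigroup (I : finType) (M : {fset {ffun I -> int}})
    (v u : {ffun I -> int}) : Prop :=
  exists c : {ffun I -> int} -> nat, u = \sum_(m <- M) (m - v) *+ c m.

(* [Q] is a lattice polytope and [M] its set of lattice points. *)
Definition very_ample (R : realType) (I : finType)
    (Q : {ffun I -> R} -> Prop) (M : {fset {ffun I -> int}}) : Prop :=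
  forall v, v \in M -> vertex Q (real_point R v) ->
  forall (u : {ffun I -> int}) (c : nat),
    (0 < c)%N -> in_semigroup M v (u *+ c) -> in_semigroup M v u.

Definition proj_space (V : finType) : multiproj :=
  @MultiProj V unit (fun _ => tt).

Definition torus_image (C : fieldType) (I : finType)
    (M : {fset {ffun I -> int}})
    (x : coord (proj_space (fset_sub_type M)) -> C) : Prop :=
  exists t : I -> C, (forall i, t i != 0) /\
    forall m : fset_sub_type M, x m = \prod_i t i ^ (val m) i.

Definition projective_toric_variety (C : fieldType) (I : finType)
    (M : {fset {ffun I -> int}}) :
    (coord (proj_space (fset_sub_type M)) -> C) -> Prop :=
  zariski_closure (@torus_image C I M).
Arguments projective_toric_variety : clear implicits.

(* The toric variety of a full-dimensional lattice polytope [Q] is the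
   projective toric variety of the lattice points of [kQ], for any [k > 0]
   such that [kQ] is very ample; up to isomorphism it does not depend on [k]
   (Cox, Little, Schenck, Toric Varieties, Definition 2.3.14). *)
Definition is_toric_variety_of (R : realType) (I : finType)
    (Q : {ffun I -> R} -> Prop) (C : fieldType) (P : multiproj)
    (J : coord_ring C P -> Prop) : Prop :=
  exists (k : nat) (M : {fset {ffun I -> int}}),
    [/\ (0 < k)%N, lattice_points (dilate k Q) M, very_ample (dilate k Q) M &
        subscheme_isomorphic_to J (projective_toric_variety C I M)].

(** * The space Theta and the two polytopes *)

(* The pairs (i, j) with 1 <= i < j <= n. *)
Definition theta_index (n : nat) : finType :=
  {p : 'I_n.+1 * 'I_n.+1 | (0 < p.1 < p.2)%N}.

Definition theta (K : Type) (n : nat) : Type := {ffun theta_index n -> K}.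

(* The coordinate at (i, j); it is only used for 1 <= i < j <= n. *)
Definition entry (K : nmodType) (n : nat) (T : theta K n) (i j : nat) : K :=
  match insub (inord i, inord j) : option (theta_index n) with
  | Some p => T p
  | None => 0
  end.

Definition P_polytope (R : realType) (n : nat) (a : nat -> int)
    (T : theta R n) : Prop :=
  (forall i j, (1 <= i < j)%N -> (j <= n)%N -> 0 <= entry T i j) /\
  (forall i j, (1 <= i < j)%N -> (j <= n)%N ->
     \sum_(j <= l < n.+1) entry T i l - \sum_(j.+1 <= l < n.+1) entry T i.+1 l
       <= (a i)%:~R).

Definition GT_polytope (R : realType) (n : nat) (a : nat -> int)
    (T : theta R n) : Prop :=
  let lambda i : R := (\sum_(i <= l < n) a l)%:~R in
  (forall i, (1 <= i <= n - 1)%N ->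
     (entry T i i.+1 <= lambda i) /\ (lambda i.+1 <= entry T i i.+1)) /\
  (forall i j, (1 <= i)%N -> (i.+1 < j)%N -> (j <= n)%N ->
     (entry T i j <= entry T i j.-1) /\ (entry T i.+1 j <= entry T i j)).

(** * Flag varieties and their Groebner degenerations *)

(* Plücker coordinates X_{i_1,...,i_k}, 1 <= k <= n-1, are indexed by the sets
   {i_1 < ... < i_k}; an element [r : 'I_n] stands for the index r + 1. *)
Definition plucker_index (n : nat) : finType :=
  {I : {set 'I_n} | (0 < #|I| < n)%N}.

(* The increasing sequence i_1, ..., i_k, numbered from 1. *)
Definition indices (n : nat) (I : plucker_index n) : seq nat :=
  [seq (nat_of_ord r).+1 | r <- enum (val I)].

Lemma plucker_factor_subproof (n : nat) (I : plucker_index n) :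
  (#|val I|.-1 < n.-1)%N.
Proof. by case: I => I /=; case: #|I| => //= k; case: n I. Qed.

(* The factor P(wedge^k C^n) is numbered k - 1. *)
Definition plucker_space (n : nat) : multiproj :=
  @MultiProj (plucker_index n) 'I_n.-1
    (fun I => Ordinal (plucker_factor_subproof I)).

Lemma plucker_size_subproof (n : nat) (I : plucker_index n) :
  (#|val I| <= n)%N.
Proof. by case: I => I /= /andP[_ /ltnW]. Qed.

(* The minor of [g] on the rows in [I] and the first #|I| columns: the flag of
   [g] is that of the spans of its first k columns. *)
Definition plucker_minor (C : fieldType) (n : nat) (g : 'M[C]_n)
    (I : plucker_index n) : C :=
  \det (\matrix_(r < #|val I|, c < #|val I|)
          g (enum_val r) (widen_ord (plucker_size_subproof I) c)).

Definition flag_variety (C : fieldType) (n : nat)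
    (x : coord (plucker_space n) -> C) : Prop :=
  exists g : 'M[C]_n, \det g = 1 /\ forall I, x I = plucker_minor g I.

Definition plucker_ideal (C : fieldType) (n : nat) :
    coord_ring C (plucker_space n) -> Prop :=
  vanishing_ideal (@flag_variety C n).
Arguments plucker_ideal : clear implicits.

Definition grad_component (C : fieldType) (P : multiproj)
    (S : coord P -> int) (d : int) (p : coord_ring C P) : coord_ring C P :=
  \sum_(m <- msupp p | \sum_(v : coord P) S v *+ m (enum_rank v) == d)
     p@_m *: 'X_[m].

Definition is_initial_part (C : fieldType) (P : multiproj)
    (S : coord P -> int) (p q : coord_ring C P) : Prop :=
  exists d : int,
    [/\ q = grad_component S d p, q <> (0 : {mpoly C[#|coord P|]}) &
        forall e : int, e < d ->
          grad_component S e p = (0 : {mpoly C[#|coord P|]})].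

Definition initial_ideal (C : fieldType) (P : multiproj)
    (S : coord P -> int) (J : coord_ring C P -> Prop) :
    coord_ring C P -> Prop :=
  ideal_gen (fun q => exists2 p, J p & is_initial_part S p q).

(* T(i_1, ..., i_k): pairs (l, i_l) with i_l > l only. *)
Definition T_vector (n : nat) (I : plucker_index n) : theta int n :=
  [ffun p : theta_index n =>
     let l : nat := (val p).1 in let j : nat := (val p).2 in
     if (l <= size (indices I))%N && (nth 0%N (indices I) l.-1 == j)
     then 1 else 0].

Definition sigma (n : nat) (A : theta int n)
    (I : coord (plucker_space n)) : int :=
  \sum_(p : theta_index n) A p * T_vector I p.

(* The ideal defining F^S. *)
Definition degenerate_flag_ideal (C : fieldType) (n : nat)
    (S : coord (plucker_space n) -> int) :
    coord_ring C (plucker_space n) -> Prop :=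
  initial_ideal S (plucker_ideal C n).
Arguments degenerate_flag_ideal : clear implicits.

(* Main.v *)
From mathcomp Require Import all_boot all_order all_algebra finmap.
From mathcomp Require Import fingroup perm boolp reals complex mpoly ring lra zify.
Require Import Defs.

(* Let [J] be the ideal of the polynomials vanishing at all the points
   [X_I = prod_l t(l, i_l)], [t] a torus point.  The inequalities on [A] make it
   a strict Monge array, so the diagonal product is the unique lowest term of the
   minor [X_I] along the curve [g(i, l) = e^a(l, i) t(l, i)] of lower triangular
   matrices: the initial ideal is contained in [J].  Conversely [J] is spanned by
   binomials.  By the Garnir relations a monomial is, modulo the Pluecker ideal, a
   combination of standard monomials; as these have distinct lowest terms, the
   initial part of the resulting relation is the monomial minus the standard
   monomial with the same lowest term.  Hence the initial ideal is [J].

   The zero locus of [J] is then compared with the projective toric variety of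
   the set [M] of exponents of monomials of multidegree [a] by the Segre-Veronese
   map [x |-> (x^m)_m]; near a point with [y_m0 != 0] its inverse is
   [X_I := y_(m0 - I_0 + I)], where the factor [I_0] of [m0] has the size of [I].
   Finally, cutting a Gelfand-Tsetlin pattern at the levels [>= 1], [>= 2], ...
   writes a lattice point of [N P] or [N GT] as the exponent of a monomial of
   multidegree [N a]; this identifies [M] with the lattice points and shows that
   both polytopes are normal. *)

Set Implicit Arguments.
Unset Strict Implicit.
Unset Printing Implicit Defensive.

Import Order.TTheory GRing.Theory Num.Theory.

Local Open Scope ring_scope.

(** * Monomials, weights and characters *)

(** Two kinds of exponents are involved. [diag_exp] is indexed by all matrix positions, the diagonal
    included, and so determines the multidegree of a monomial; [T_vector] and [GT_vector] live on
    the pairs [i < j] and lose it. They separate the same monomials only within one multidegree,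
    which is why the criterion carries two exponent maps. What makes all three comparable is
    [row_count]: the row counts of a tableau form a Gelfand-Tsetlin pattern, [diag_exp] and
    [T_vector] are its differences along rows, and [GT_vector] lists its entries outside the last
    column. No map between the polytopes is built; both are compared with the same ideal.

    The inequalities on [A] concern pairs [i < j] only, whereas the rearrangement argument needs a
    Monge array on a full square, hence artificial weights above the diagonal. Straightening has to
    terminate for columns of different lengths: the measure is the sum of the squares of the keys,
    which grows when an exchange moves two keys further apart with their sum fixed. *)

Definition mult (V : finType) (m : 'X_{1..#|V|}) (v : V) : nat :=
  m (enum_rank v).

Definition mvar (V : finType) (v : V) : 'X_{1..#|V|} := U_(enum_rank v)%MM.

Definition wt (V : finType) (A : nmodType) (F : V -> A) (m : 'X_{1..#|V|}) : A :=
  \sum_v F v *+ mult m v.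

Definition fdeg (V D : finType) (fac : V -> D) (m : 'X_{1..#|V|}) (d : D) : nat :=
  \sum_(v | fac v == d) mult m v.

Definition monv (C : comNzRingType) (V : finType) (x : V -> C)
    (m : 'X_{1..#|V|}) : C :=
  \prod_v x v ^+ mult m v.

Definition charv (C : fieldType) (I : finType) (t : I -> C)
    (e : {ffun I -> int}) : C :=
  \prod_i t i ^ e i.

Section Monomials.
Variable V : finType.
Implicit Types (m : 'X_{1..#|V|}) (v w : V).

Lemma multP m m' : mult m =1 mult m' -> m = m'.
Proof.
by move=> h; apply/mnmP => i; move: (h (enum_val i)); rewrite /mult enum_valK.
Qed.

Lemma mult0 v : mult (0%MM : 'X_{1..#|V|}) v = 0%N.
Proof. exact: mnm0E. Qed.

Lemma multD m m' v : mult (m + m')%MM v = (mult m v + mult m' v)%N.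
Proof. exact: mnmDE. Qed.

Lemma multB m m' v : mult (m - m')%MM v = (mult m v - mult m' v)%N.
Proof. exact: mnmBE. Qed.

Lemma mult_mvar v w : mult (mvar v) w = (v == w).
Proof. by rewrite /mult mnm1E (inj_eq enum_rank_inj). Qed.

Lemma mvar_le m v : (0 < mult m v)%N -> (m - mvar v + mvar v)%MM = m.
Proof. by move=> h; apply: submK; rewrite lep1mP -lt0n. Qed.

Lemma wt0 (A : nmodType) (F : V -> A) : wt F 0%MM = 0.
Proof. by rewrite /wt big1 // => v _; rewrite mult0. Qed.

Lemma wtD (A : nmodType) (F : V -> A) m m' : wt F (m + m')%MM = wt F m + wt F m'.
Proof. by rewrite -big_split; apply: eq_bigr => v _; rewrite multD mulrnDr. Qed.

Lemma wt_mvar (A : nmodType) (F : V -> A) v : wt F (mvar v) = F v.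
Proof.
rewrite /wt (bigD1 v) //= mult_mvar eqxx big1 ?addr0 // => w /negbTE.
by rewrite mult_mvar eq_sym => ->.
Qed.

Lemma wtMn (A : nmodType) (F : V -> A) m k : wt F (m *+ k)%MM = wt F m *+ k.
Proof.
by elim: k => [|k IH]; rewrite ?mulm0n ?wt0 // mulmS wtD IH mulrS.
Qed.

Lemma wt_sum (A : nmodType) (F : V -> A) (J : Type) (r : seq J) (P : pred J) f :
  wt F (\big[+%MM/0%MM]_(j <- r | P j) f j) = \sum_(j <- r | P j) wt F (f j).
Proof. by elim/big_rec2: _ => [|j _ y _ <-]; rewrite ?wt0 ?wtD. Qed.

Lemma wt_ffunE (A : nmodType) (K : finType) (F : V -> {ffun K -> A}) m k :
  wt F m k = wt (fun v => F v k) m.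
Proof. by rewrite /wt sum_ffunE; apply: eq_bigr => v _; rewrite ffunMnE. Qed.

Section Multidegree.
Variables (D : finType) (fac : V -> D).

Lemma fdegD m m' d : fdeg fac (m + m')%MM d = (fdeg fac m d + fdeg fac m' d)%N.
Proof. by rewrite -big_split; apply: eq_bigr => v _; rewrite multD. Qed.

Lemma fdeg0 d : fdeg fac 0%MM d = 0%N.
Proof. by rewrite /fdeg big1 // => v _; rewrite mult0. Qed.

Lemma fdeg_mvar v d : fdeg fac (mvar v) d = (fac v == d).
Proof.
rewrite /fdeg; under eq_bigr do rewrite mult_mvar.
case: eqP => [<-|/eqP h]; last first.
  by rewrite big1 // => w /eqP fw; case: eqP => // e; move: h; rewrite e fw eqxx.
rewrite (bigD1 v) //= eqxx big1 ?addn0 // => w /andP[_].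
by rewrite eq_sym => /negbTE ->.
Qed.

Lemma fdegMn m k d : fdeg fac (m *+ k)%MM d = (fdeg fac m d * k)%N.
Proof.
by elim: k => [|k IH]; rewrite ?mulm0n ?fdeg0 ?muln0 // mulmS fdegD IH mulnS.
Qed.

Lemma fdeg_sum (J : Type) (r : seq J) (P : pred J) f d :
  fdeg fac (\big[+%MM/0%MM]_(j <- r | P j) f j) d =
  (\sum_(j <- r | P j) fdeg fac (f j) d)%N.
Proof. by elim/big_rec2: _ => [|j _ y _ <-]; rewrite ?fdeg0 ?fdegD. Qed.

Lemma wt_fac (A : nmodType) (G : D -> A) m :
  wt (fun v => G (fac v)) m = \sum_d G d *+ fdeg fac m d.
Proof.
rewrite /wt (partition_big fac predT) //=; apply: eq_bigr => d _.
by rewrite -sumrMnr; apply: eq_bigr => v /eqP ->.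
Qed.

Lemma fdeg_gt0 m d : (0 < fdeg fac m d)%N ->
  exists v, fac v = d /\ (0 < mult m v)%N.
Proof.
move=> h; case: (pickP (fun v => (fac v == d) && (0 < mult m v)%N)) => [v|h0].
  by case/andP => /eqP; exists v.
move: h; rewrite /fdeg big1 // => v fv; move: (h0 v); rewrite fv /=.
by case: (mult m v).
Qed.

End Multidegree.

Lemma monv0 (C : comNzRingType) (x : V -> C) : monv x 0%MM = 1.
Proof. by rewrite /monv big1 // => v _; rewrite mult0 expr0. Qed.

Lemma monvD (C : comNzRingType) (x : V -> C) m m' :
  monv x (m + m')%MM = monv x m * monv x m'.
Proof. by rewrite -big_split; apply: eq_bigr => v _; rewrite multD exprD. Qed.

Lemma monv_mvar (C : comNzRingType) (x : V -> C) v : monv x (mvar v) = x v.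
Proof.
rewrite /monv (bigD1 v) //= mult_mvar eqxx big1 ?mulr1 // => w /negbTE.
by rewrite mult_mvar eq_sym => ->.
Qed.

Lemma monvMn (C : comNzRingType) (x : V -> C) m k :
  monv x (m *+ k)%MM = monv x m ^+ k.
Proof.
by elim: k => [|k IH]; rewrite ?mulm0n ?monv0 // mulmS monvD IH exprS.
Qed.

Lemma monv_sum (C : comNzRingType) (x : V -> C) (J : Type) (r : seq J)
    (P : pred J) f :
  monv x (\big[+%MM/0%MM]_(j <- r | P j) f j) = \prod_(j <- r | P j) monv x (f j).
Proof. by elim/big_rec2: _ => [|j _ y _ <-]; rewrite ?monv0 ?monvD. Qed.

Lemma monv_neq0 (C : fieldType) (x : V -> C) m :
  (forall v, (0 < mult m v)%N -> x v != 0) -> monv x m != 0.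
Proof.
move=> h; apply/prodf_neq0 => v _; rewrite expf_eq0 negb_and.
by case: (ltnP 0 (mult m v)) => [/h ->|_]; rewrite ?orbT.
Qed.

Lemma charv_neq0 (C : fieldType) (I : finType) (t : I -> C) e :
  (forall i, t i != 0) -> charv t e != 0.
Proof. by move=> h; apply/prodf_neq0 => i _; apply: expfz_neq0. Qed.

Lemma charv0 (C : fieldType) (I : finType) (t : I -> C) : charv t 0 = 1.
Proof. by rewrite /charv big1 // => i _; rewrite ffunE expr0z. Qed.

Lemma charvD (C : fieldType) (I : finType) (t : I -> C) e f :
  (forall i, t i != 0) -> charv t (e + f) = charv t e * charv t f.
Proof.
by move=> h; rewrite -big_split; apply: eq_bigr => i _; rewrite ffunE expfzDr.
Qed.

Lemma charvMn (C : fieldType) (I : finType) (t : I -> C) e k :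
  (forall i, t i != 0) -> charv t (e *+ k) = charv t e ^+ k.
Proof.
by move=> h; elim: k => [|k IH]; rewrite ?charv0 // mulrS charvD // IH exprS.
Qed.

Lemma monv_charv (C : fieldType) (I : finType) (t : I -> C)
    (E : V -> {ffun I -> int}) m :
  (forall i, t i != 0) -> monv (fun v => charv t (E v)) m = charv t (wt E m).
Proof.
move=> h; rewrite /wt /monv; elim/big_rec2: _ => [|v y z _ ->].
  by rewrite charv0.
by rewrite charvD // charvMn.
Qed.

End Monomials.

Lemma charv_mul (C : fieldType) (I : finType) (t u : I -> C) e :
  charv (fun i => t i * u i) e = charv t e * charv u e.
Proof.
by rewrite -big_split; apply: eq_bigr => i _; rewrite expfzMl.
Qed.

Lemma exp2z_inj (C : numFieldType) : injective (fun a : int => (2 : C) ^ a).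
Proof.
move=> a b; wlog le_ab : a b / a <= b => [hw|] /= e2.
  by case/orP: (le_total a b) => h; [apply: hw | symmetry; apply: hw].
have [k ek] : exists k : nat, b = a + k.
  by exists `|b - a|%N; lia.
have two0 : (2 : C) != 0 by rewrite pnatr_eq0.
have /eqP : (2 : C) ^+ k = 2 ^+ 0.
  apply: (mulfI (expfz_neq0 a two0)).
  by rewrite exprnP -expfzDr // -ek -e2 mulr1.
have gt0 : 0 < (2 : C) by rewrite ltr0n.
have ne1 : (2 : C) != 1 by rewrite (@eqr_nat C 2 1).
by move=> /eqP/(ieexprIn gt0 ne1) h; rewrite ek h addr0.
Qed.

(** Dedekind's argument: subtracting [charv u e0] times the relation at [t] from the relation at
    [u * t] removes the term of [e0] and multiplies the other coefficients by
    [charv u e - charv u e0]. *)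
Lemma charv_independent (C : numFieldType) (I : finType)
    (s : seq {ffun I -> int}) (c : {ffun I -> int} -> C) :
  uniq s ->
  (forall t : I -> C, (forall i, t i != 0) -> \sum_(e <- s) c e * charv t e = 0) ->
  forall e, e \in s -> c e = 0.
Proof.
elim: s c => [|e0 s IH] c //= /andP[e0s us] h.
have hs e1 : e1 \in s -> c e1 = 0.
  move=> e1s.
  have ne : e1 != e0 by apply: contraNneq e0s => <-.
  have [i ni] : exists i, e1 i != e0 i.
    apply/existsP; apply: contraNT ne => /existsPn H.
    by apply/eqP/ffunP => i; apply/eqP; move: (H i); rewrite negbK.
  (* [u] is 2 at one coordinate where [e1] and [e0] differ; powers of 2 being distinct in
     characteristic 0, [charv u] separates them. *)
  pose u j : C := if j == i then 2 else 1.
  have u0 j : u j != 0.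
    by rewrite /u; case: (j == i); rewrite ?oner_neq0 ?pnatr_eq0.
  have cu e : charv u e = 2 ^ e i.
    rewrite /charv (bigD1 i) //= {1}/u eqxx big1 ?mulr1 // => j /negbTE ji.
    by rewrite /u ji exp1rz.
  have := IH (fun e => c e * (charv u e - charv u e0)) us.
  move=> /(_ _ _ e1s) H.
  have {H}/eqP : c e1 * (charv u e1 - charv u e0) = 0.
    apply: H => t t0.
    have ut0 j : u j * t j != 0 by rewrite mulf_neq0.
    have := h _ ut0; have := h _ t0; rewrite !big_cons => h1 h2.
    have -> : \sum_(e <- s) c e * (charv u e - charv u e0) * charv t e =
      \sum_(e <- s) c e * charv (fun j => u j * t j) e
        - charv u e0 * \sum_(e <- s) c e * charv t e.
      rewrite mulr_sumr -sumrB; apply: eq_bigr => e _; rewrite charv_mul; ring.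
    have -> := canRL (addKr _) h2; have -> := canRL (addKr _) h1.
    rewrite charv_mul; ring.
  rewrite mulf_eq0 subr_eq0 => /orP[/eqP //|].
  rewrite !cu => /eqP e2; case/negP: ni; apply/eqP.
  exact: exp2z_inj e2.
move=> e; rewrite inE => /predU1P[->|]; last exact: hs.
have := h (fun=> 1) (fun=> oner_neq0 _).
rewrite big_cons big_seq big1 ?addr0; last by move=> f /hs ->; rewrite mul0r.
move/eqP; rewrite mulf_eq0 (negbTE (charv_neq0 _ _)) ?orbF; first by move/eqP.
by move=> _; exact: oner_neq0.
Qed.

(** * Ideals of binomials *)

Section IdealGen.
Variables (C : fieldType) (P : multiproj).
Implicit Types (G : coord_ring C P -> Prop) (p q : {mpoly C[#|coord P|]}).

Lemma ideal_gen_in G p : G p -> ideal_gen G p.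
Proof.
move=> Gp; exists [:: (1 : {mpoly C[#|coord P|]}, p : coord_ring C P)]; split.
  by move=> cg; rewrite inE => /eqP ->.
by rewrite big_seq1 /= mul1r.
Qed.

Lemma ideal_gen0 G : ideal_gen G (0 : {mpoly C[#|coord P|]}).
Proof. by exists [::]; rewrite big_nil. Qed.

Lemma ideal_genD G p q :
  ideal_gen G p -> ideal_gen G q -> ideal_gen G (p + q : {mpoly C[#|coord P|]}).
Proof.
move=> [s [hs ->]] [s' [hs' ->]]; exists (s ++ s'); rewrite big_cat; split=> //.
by move=> cg; rewrite mem_cat => /orP[/hs|/hs'].
Qed.

Lemma ideal_genM G p q : ideal_gen G q -> ideal_gen G (p * q : {mpoly C[#|coord P|]}).
Proof.
move=> [s [hs ->]]; exists [seq (p * cg.1 : {mpoly C[#|coord P|]}, cg.2) | cg <- s]; split.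
  by move=> _ /mapP[cg /hs ? ->].
by rewrite big_map mulr_sumr; apply: eq_bigr => cg _; rewrite mulrA.
Qed.

Lemma ideal_genZ G (c : C) q : ideal_gen G q -> ideal_gen G (c *: q : {mpoly C[#|coord P|]}).
Proof. by rewrite -mul_mpolyC; exact: ideal_genM. Qed.

Lemma evalpE p (x : coord P -> C) :
  evalp (P := P) p x = \sum_(m <- msupp p) p@_m * monv x m.
Proof.
rewrite /evalp mevalE; apply: eq_bigr => m _; congr (_ * _).
rewrite /monv (reindex (@enum_val (coord P) predT)) /=; last first.
  by exists enum_rank => i _; rewrite ?enum_valK ?enum_rankK.
by apply: eq_bigr => i _; rewrite /mult enum_valK.
Qed.

Lemma evalpD p q (x : coord P -> C) :
  evalp (P := P) (p + q) x =
  evalp (P := P) p x + evalp (P := P) q x.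
Proof. exact: mevalD. Qed.

Lemma evalpB p q (x : coord P -> C) :
  evalp (P := P) (p - q) x =
  evalp (P := P) p x - evalp (P := P) q x.
Proof. exact: mevalB. Qed.

Lemma evalpZ (c : C) p (x : coord P -> C) :
  evalp (P := P) (c *: p) x = c * evalp (P := P) p x.
Proof. exact: mevalZ. Qed.

Lemma evalp0 (x : coord P -> C) :
  evalp (P := P) (0) x = 0.
Proof. exact: meval0. Qed.

Lemma evalpX m (x : coord P -> C) :
  evalp (P := P) ('X_[m]) x = monv x m.
Proof. by rewrite evalpE msuppX big_seq1 mcoeffX eqxx mul1r. Qed.

Lemma evalp_ideal_gen G p (x : coord P -> C) :
  (forall g, G g -> evalp g x = 0) -> ideal_gen G p ->
  evalp (P := P) p x = 0.
Proof.
move=> hG [s [hs ->]]; rewrite /evalp raddf_sum /= big_seq big1 // => cg /hs/hG.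
by rewrite mevalM /evalp => ->; rewrite mulr0.
Qed.

Lemma has_multidegreeX m :
  has_multidegree (C := C) (P := P) (fdeg (@fac P) m) 'X_[m].
Proof. by move=> m'; rewrite msuppX inE => /eqP ->. Qed.

Lemma has_multidegreeB delta p q :
  has_multidegree (C := C) (P := P) delta p ->
  has_multidegree (C := C) (P := P) delta q ->
  has_multidegree (C := C) (P := P) delta (p - q).
Proof.
by move=> hp hq m /msuppB_le; rewrite mem_cat => /orP[/hp|/hq].
Qed.

End IdealGen.

Lemma partition_big_map (A : nmodType) (T U : eqType) (r : seq T) (g : T -> U)
    (f : T -> A) :
  \sum_(m <- r) f m =
  \sum_(e <- undup (map g r)) \sum_(m <- r | g m == e) f m.
Proof.
rewrite (exchange_big_dep predT) //= big_seq [RHS]big_seq.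
apply: eq_bigr => m mr.
rewrite big_mkcond (bigD1_seq (g m)) ?undup_uniq ?mem_undup ?map_f //= eqxx.
by rewrite big1 ?addr0 // => e; rewrite eq_sym => /negbTE ->.
Qed.

Section TorusVanishing.
Variables (C : numFieldType) (P : multiproj) (I : finType).
Variable E : coord P -> {ffun I -> int}.
Implicit Types p : {mpoly C[#|coord P|]}.

Definition torus_vanishing p : Prop :=
  forall t : I -> C, (forall i, t i != 0) -> evalp (P := P) p (fun v => charv t (E v)) = 0.

(** On the torus [p] becomes a combination of distinct characters with these sums as coefficients,
    and characters are linearly independent. *)
Lemma torus_class_sum p e :
  torus_vanishing p -> \sum_(m <- msupp p | wt E m == e) p@_m = 0.
Proof.
move=> hp; pose s := undup (map (wt E) (msupp p)).
have [es|es] := boolP (e \in s); last first.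
  rewrite big_seq_cond big_pred0 // => m; apply/negP => /andP[mp /eqP h].
  by case/negP: es; rewrite mem_undup -h map_f.
apply: (charv_independent (c := fun e => \sum_(m <- msupp p | wt E m == e) p@_m)
         (undup_uniq _) _ es) => t t0.
have := hp t t0; rewrite evalpE (partition_big_map _ (wt E)) => hp0.
rewrite -[RHS]hp0.
apply: eq_bigr => f _; rewrite mulr_suml; apply: eq_bigr => m /eqP <-.
by rewrite monv_charv.
Qed.

(** As the coefficients of each weight class sum to 0, all monomials of a class can be compared with
    a fixed one. The binomials only involve monomials in the support of [p], so they are
    multihomogeneous when [p] is. *)
Lemma torus_vanishing_ind (J : {mpoly C[#|coord P|]} -> Prop) p :
  J 0 -> (forall q r, J q -> J r -> J (q + r)) ->
  (forall c q, J q -> J (c *: q)) ->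
  torus_vanishing p ->
  (forall m m', m \in msupp p -> m' \in msupp p -> wt E m = wt E m' ->
     J ('X_[m] - 'X_[m'])) ->
  J p.
Proof.
move=> J0 JD JZ hp hb; rewrite [p]mpolyE (partition_big_map _ (wt E)).
apply: (big_ind J) => // e _.
have [[m0 /andP[m0p /eqP <-]]|H] :=
    pselect (exists m, (m \in msupp p) && (wt E m == e)); last first.
  rewrite big_seq_cond big_pred0 // => m.
  by apply/negP => h; apply: H; exists m.
have -> : \sum_(m <- msupp p | wt E m == wt E m0) p@_m *: 'X_[m] =
    \sum_(m <- msupp p | wt E m == wt E m0) p@_m *: ('X_[m] - 'X_[m0]).
  under [RHS]eq_bigr do rewrite scalerBr.
  by rewrite sumrB -scaler_suml torus_class_sum // scale0r subr0.
rewrite big_seq_cond; apply: (big_ind J) => // m /andP[mp /eqP h].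
exact/JZ/hb.
Qed.

Lemma torus_vanishingB m m' : wt E m = wt E m' ->
  torus_vanishing ('X_[m] - 'X_[m'] : {mpoly C[#|coord P|]}).
Proof. by move=> h t t0; rewrite evalpB !evalpX !monv_charv // h subrr. Qed.

End TorusVanishing.

(** Equations are imposed within a multidegree only: others would not be invariant under rescaling
    the homogeneous coordinates of a factor. *)
Definition toric_locus (C : fieldType) (P : multiproj) (I : finType)
    (E : coord P -> {ffun I -> int}) (x : coord P -> C) : Prop :=
  is_point x /\
  forall m m' : 'X_{1..#|coord P|}, wt E m = wt E m' ->
    (forall d, fdeg (@fac P) m d = fdeg (@fac P) m' d) -> monv x m = monv x m'.

Section ToricLocus.
Variables (C : numFieldType) (P : multiproj) (I : finType).
Variable E : coord P -> {ffun I -> int}.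

Lemma zero_locus_torus_vanishing (J : coord_ring C P -> Prop) :
  (forall p, J p <-> torus_vanishing E p) ->
  (forall m m', wt E m = wt E m' ->
     forall d, fdeg (@fac P) m d = fdeg (@fac P) m' d) ->
  forall x, zero_locus J x <-> toric_locus E x.
Proof.
move=> hJ hE x; split=> -[px h]; split=> //.
  move=> m m' hw _; apply/eqP; rewrite -subr_eq0 -!evalpX -evalpB; apply/eqP.
  by apply: h; apply/hJ/torus_vanishingB.
move=> p /hJ hp.
apply: (torus_vanishing_ind (J := fun q => evalp (P := P) q x = 0) _ _ _ hp).
- exact: evalp0.
- by move=> q r hq hr; rewrite evalpD hq hr addr0.
- by move=> c q hq; rewrite evalpZ hq mulr0.
move=> m m' _ _ hw; rewrite evalpB !evalpX (h m m') ?subrr //.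
exact: hE.
Qed.

Lemma toric_closureP (X : (coord P -> C) -> Prop) :
  (forall x, X x <-> exists t : I -> C, (forall i, t i != 0) /\
                       forall v, x v = charv t (E v)) ->
  forall x, zariski_closure X x <-> toric_locus E x.
Proof.
move=> hX x; split=> -[px h]; split=> //.
  move=> m m' hw hd; apply/eqP; rewrite -subr_eq0 -!evalpX -evalpB; apply/eqP.
  apply: h; apply: ideal_gen_in; split.
    exists (fdeg (@fac P) m); apply: has_multidegreeB; first exact: has_multidegreeX.
    move=> m0; rewrite msuppX inE => /eqP -> d; rewrite hd.
    by [].
  move=> y /hX [t [t0 yE]].
  by rewrite (funext yE); apply: torus_vanishingB.
move=> p; apply: evalp_ideal_gen => g [[delta hg] gX].
apply: (torus_vanishing_ind (E := E)
         (J := fun q => evalp (P := P) q x = 0)).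
- exact: evalp0.
- by move=> q r hq hr; rewrite evalpD hq hr addr0.
- by move=> c q hq; rewrite evalpZ hq mulr0.
- by move=> t t0; apply: gX; apply/hX; exists t.
move=> m m' /hg hm /hg hm' hw; rewrite evalpB !evalpX (h m m') ?subrr // => d.
exact: etrans (hm d) (esym (hm' d)).
Qed.

End ToricLocus.

(** * Isomorphisms of toric loci *)

Section Reduced.
Variables (C : numFieldType) (P : multiproj) (I : finType).
Variable E : coord P -> {ffun I -> int}.
Variable J : coord_ring C P -> Prop.
Hypothesis fac_surj : forall d : factor P, exists v : coord P, fac v = d.
Hypothesis JE : forall p, J p <-> torus_vanishing E p.

Lemma zero_locus_charv (t : I -> C) :
  (forall i, t i != 0) -> zero_locus J (fun v => charv t (E v)).
Proof.
move=> t0; split=> [d|p /JE]; last exact.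
by have [v vd] := fac_surj d; exists v; rewrite charv_neq0.
Qed.

(** Torus points belong to the zero locus, so a polynomial vanishing on the locus vanishes on the
    torus and lies in [J] itself, with [h = 1]. *)
Lemma torus_vanishing_reduced : reduced_subscheme J.
Proof.
move=> f x _ fJ _; exists (1 : {mpoly C[#|coord P|]}); split.
- exists (fun=> 0%N) => m; rewrite msupp1 inE => /eqP -> d.
  exact: (fdeg0 (@fac P)).
- by rewrite /evalp meval1 oner_neq0.
rewrite mul1r; apply/JE => t t0; exact/fJ/zero_locus_charv.
Qed.

End Reduced.

Section ToricIsomorphism.
Variables (C : numFieldType) (P : multiproj) (I : finType).
Variables (F : coord P -> {ffun I -> int}) (V : finType).
Variables (E : V -> {ffun I -> int}) (delta : factor P -> nat).

Local Notation deg := (fdeg (@fac P)).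
Local Notation Q := (proj_space V).
Local Notation X := (toric_locus (C := C) F).
Local Notation Y := (toric_locus (C := C) (P := Q) E).

Hypothesis E_inj : injective E.
Hypothesis delta_gt0 : forall d, (0 < delta d)%N.

Variable mono : V -> 'X_{1..#|coord P|}.
Hypothesis mono_deg : forall v d, deg (mono v) d = delta d.
Hypothesis mono_wt : forall v, wt F (mono v) = E v.

Variable cls : 'X_{1..#|coord P|} -> V.
Hypothesis clsP : forall m, (forall d, deg m d = delta d) -> E (cls m) = wt F m.

Variable sel : V -> factor P -> coord P.
Hypothesis sel_fac : forall v d, fac (sel v d) = d.
Hypothesis sel_mono : forall v d, (0 < mult (mono v) (sel v d))%N.

(** [V] stands for the set of weights of multidegree [delta], [mono v] for a chosen monomial of
    weight [v], and [sel v d] for a variable of the factor [d] dividing it. The exchange stays in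
    multidegree [delta], so its weight [cls] is again in [V]. *)
Definition swap v0 v := (mono v0 - mvar (sel v0 (fac v)) + mvar v)%MM.

Definition segre (x : coord P -> C) : coord Q -> C := fun v => monv x (mono v).

Definition unsegre_at (v0 : V) (y : coord Q -> C) : coord P -> C :=
  fun v => y (cls (swap v0 v)).

(** A global inverse has to choose a chart; by [unsegre_at_same] the choice only affects the
    scaling. The default 0 is reached only if all coordinates of [y] vanish, which happens at no
    point. *)
Definition unsegre (y : coord Q -> C) : coord P -> C :=
  if [pick v0 | y v0 != 0] is Some v0 then unsegre_at v0 y else fun=> 0.

Lemma swap_deg v0 v d : deg (swap v0 v) d = delta d.
Proof.
rewrite /swap -(mono_deg v0) -{2}(mvar_le (sel_mono v0 (fac v))) !fdegD.
by rewrite !fdeg_mvar sel_fac.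
Qed.

Lemma swap_wt v0 v : wt F (swap v0 v) = E v0 - F (sel v0 (fac v)) + F v.
Proof.
rewrite /swap wtD wt_mvar; congr (_ + _).
rewrite -(mono_wt v0) -{2}(mvar_le (sel_mono v0 (fac v))) wtD wt_mvar addrK.
by [].
Qed.

Lemma cls_swap v0 v : E (cls (swap v0 v)) = E v0 - F (sel v0 (fac v)) + F v.
Proof. by rewrite clsP ?swap_wt // => d; rewrite swap_deg. Qed.

Lemma cls_swap_sel v0 d : cls (swap v0 (sel v0 d)) = v0.
Proof. by apply: E_inj; rewrite cls_swap sel_fac subrK. Qed.

Lemma toric_locus_quad (y : coord Q -> C) (a b c d : V) : Y y ->
  E a + E b = E c + E d -> y a * y b = y c * y d.
Proof.
move=> [_ h] e; rewrite -!monv_mvar -!monvD; apply: h => [|u].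
  by rewrite !wtD !wt_mvar.
by rewrite !fdegD !fdeg_mvar.
Qed.

Lemma unsegre_at_neq0 v0 y v : Y y -> y v0 != 0 ->
  (0 < mult (mono v0) v)%N -> unsegre_at v0 y v != 0.
Proof.
move=> hy y0 hv; set d := fac v.
(* [m'] is the reverse exchange: its weight and that of [swap v0 v] add up to twice [E v0], so the
   product of the two coordinates is [y v0 ^+ 2]. *)
pose m' := (mono v0 - mvar v + mvar (sel v0 d))%MM.
have m'deg e : deg m' e = delta e.
  rewrite /m' -(mono_deg v0) -{2}(mvar_le hv) !fdegD.
  by rewrite !fdeg_mvar sel_fac.
have hq : y (cls (swap v0 v)) * y (cls m') = y v0 * y v0.
  apply: toric_locus_quad hy _; rewrite cls_swap clsP // /m' wtD wt_mvar -!(mono_wt v0).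
  rewrite -{3}(mvar_le hv) wtD wt_mvar -/d.
  by apply/ffunP => i; rewrite !ffunE; ring.
by apply: contraNneq y0 => h; move: hq; rewrite -/(unsegre_at v0 y v) h mul0r => /esym/eqP; rewrite mulf_eq0 orbb.
Qed.

(** On the factor [d] the scaling is read off at the coordinate [sel w0 d], where the chart of [w0]
    takes the value [y w0]. *)
Lemma unsegre_at_same v0 w0 y : Y y ->
  y v0 != 0 -> y w0 != 0 -> same_point (unsegre_at v0 y) (unsegre_at w0 y).
Proof.
move=> hy v00 w00.
have hq v : unsegre_at v0 y v * y w0 =
    unsegre_at v0 y (sel w0 (fac v)) * unsegre_at w0 y v.
  apply: toric_locus_quad hy _; rewrite !cls_swap sel_fac.
  by apply/ffunP => i; rewrite !ffunE; ring.
have h0 d : unsegre_at v0 y (sel w0 d) != 0.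
  have := hq (sel v0 d); rewrite {1}/unsegre_at cls_swap_sel sel_fac => h.
  by apply: contraTneq (mulf_neq0 v00 w00) => e; rewrite h e mul0r eqxx.
exists (fun d => y w0 / unsegre_at v0 y (sel w0 d)); split=> [d|v].
  by rewrite mulf_neq0 ?invr_eq0.
by apply: (mulfI (h0 (fac v))); rewrite -hq [LHS]mulrC mulrA mulrCA divff ?mulr1.
Qed.

Lemma unsegreE v0 y : Y y -> y v0 != 0 ->
  same_point (unsegre_at v0 y) (unsegre y).
Proof.
move=> hy y0; rewrite /unsegre; case: pickP => [w0 w00|/(_ v0)]; last by rewrite y0.
exact: unsegre_at_same.
Qed.

Lemma segre_locus x : X x -> Y (segre x).
Proof.
move=> [px h]; split=> [[]|m m' hw hd].
  (* To find a nonzero coordinate of the image, multiply nonzero coordinates of [x], one for each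
     factor [d], to the powers [delta d]. The chosen monomial of the same weight has the same value
     at [x]. *)
  have [c cP] := choice px.
  pose m := (\big[+%MM/0%MM]_d (mvar (c d) *+ delta d)%MM : 'X_{1..#|coord P|}).
  have md d : deg m d = delta d.
    rewrite fdeg_sum (bigD1 d) //= fdegMn fdeg_mvar (cP d).1 eqxx mul1n.
    rewrite big1 ?addn0 // => e /negbTE ed.
    by rewrite fdegMn fdeg_mvar (cP e).1 ed.
  exists (cls m); split=> //; rewrite /segre (h _ m).
  - rewrite monv_sum; apply/prodf_neq0 => d _.
    by rewrite monvMn monv_mvar expf_neq0 // (cP d).2.
  - by rewrite mono_wt clsP.
  by move=> d; rewrite mono_deg md.
have e m0 : monv (segre x) m0 =
    monv x (\big[+%MM/0%MM]_v (mono v *+ mult m0 v)%MM).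
  by rewrite monv_sum; apply: eq_bigr => v _; rewrite monvMn.
rewrite !e; apply: h => [|d].
  rewrite !wt_sum.
  have w m0 : \sum_v wt F (mono v *+ mult m0 v)%MM = wt E m0.
    by apply: eq_bigr => v _; rewrite wtMn mono_wt.
  by rewrite !w.
rewrite !fdeg_sum.
have w m0 : (\sum_v deg (mono v *+ mult m0 v)%MM d = delta d * fdeg (@fac Q) m0 tt)%N.
  by rewrite big_distrr; apply: eq_bigr => v _; rewrite fdegMn mono_deg.
by rewrite !w hd.
Qed.

Definition unsegre_mono v0 (m : 'X_{1..#|coord P|}) : 'X_{1..#|coord Q|} :=
  (\big[+%MM/0%MM]_v (mvar (cls (swap v0 v)) *+ mult m v))%MM.

Lemma monv_unsegre_at v0 y m :
  monv (unsegre_at v0 y) m = monv y (unsegre_mono v0 m).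
Proof.
by rewrite monv_sum; apply: eq_bigr => v _; rewrite monvMn monv_mvar.
Qed.

(** The first term depends only on [v0] and the multidegree, so monomials of equal weight and
    multidegree still have equal weights; this carries the equations of [Y] over to [X]. *)
Lemma unsegre_mono_wt v0 m :
  wt E (unsegre_mono v0 m) =
  \sum_d (E v0 - F (sel v0 d)) *+ deg m d + wt F m.
Proof.
rewrite wt_sum -(wt_fac (@fac P) (fun d => E v0 - F (sel v0 d))) -big_split.
by apply: eq_bigr => v _; rewrite wtMn wt_mvar cls_swap mulrnDl.
Qed.

Lemma unsegre_mono_deg v0 m u :
  fdeg (@fac Q) (unsegre_mono v0 m) u = (\sum_d deg m d)%N.
Proof.
transitivity (\sum_v mult m v)%N; last exact: (partition_big (@fac P) predT).
rewrite fdeg_sum.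
by apply: eq_bigr => v _; rewrite fdegMn fdeg_mvar; case: u; rewrite mul1n.
Qed.

Lemma unsegre_at_locus v0 y : Y y -> y v0 != 0 ->
  X (unsegre_at v0 y).
Proof.
move=> hy y0; split=> [d|m m' hw hd].
  by exists (sel v0 d); rewrite sel_fac /unsegre_at cls_swap_sel.
rewrite !monv_unsegre_at; apply: hy.2 => [|u].
  by rewrite !unsegre_mono_wt hw; under eq_bigr do rewrite hd.
by rewrite !unsegre_mono_deg; under eq_bigr do rewrite hd.
Qed.

Lemma toric_locus_point (y : coord Q -> C) : Y y -> exists v0 : V, y v0 != 0.
Proof. by move=> [h _]; have [v [_ v0]] := h tt; exists v. Qed.

Lemma segreK x : X x -> same_point x (unsegre (segre x)).
Proof.
move=> hx; have hy := segre_locus hx; rewrite /unsegre; case: pickP; last first.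
  by have [v v0] := toric_locus_point hy => /(_ v); rewrite v0.
(* The scaling on the factor [d] is the cofactor of [sel v0 d] in [mono v0], nonzero at [x] because
   the whole monomial is. *)
move=> v0 y0; exists (fun d => monv x (mono v0 - mvar (sel v0 d))%MM); split=> [d|v].
  move: y0; rewrite /segre -{1}(mvar_le (sel_mono v0 d)) monvD mulf_eq0 negb_or.
  by case/andP.
rewrite /unsegre_at /segre -[x v in RHS]monv_mvar -monvD; apply: hx.2 => [|d].
  by rewrite mono_wt cls_swap -/(swap v0 v) swap_wt.
by rewrite mono_deg -/(swap v0 v) swap_deg.
Qed.

Lemma unsegreK y : Y y -> same_point y (segre (unsegre y)).
Proof.
move=> hy; rewrite /unsegre; case: pickP; last first.
  by have [v v0] := toric_locus_point hy => /(_ v); rewrite v0.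
(* [mono v] and [mono v0] have the same multidegree, so the extra terms in their weights agree: the
   composite multiplies every coordinate of [y] by the same factor, determined at [v0]. *)
move=> v0 y0; pose c := segre (unsegre_at v0 y) v0.
have c0 : c != 0 by apply: monv_neq0 => v; exact: unsegre_at_neq0.
exists (fun=> c / y v0); split=> [_|v]; first by rewrite mulf_neq0 ?invr_eq0.
apply: (mulfI y0); rewrite mulrA mulrCA divff // mulr1 /c /segre.
rewrite !monv_unsegre_at -[y v0]monv_mvar -[y v]monv_mvar -!monvD.
apply: hy.2 => [|u].
  rewrite !wtD !wt_mvar !unsegre_mono_wt !mono_wt.
  under eq_bigr do rewrite mono_deg.
  under [in RHS]eq_bigr do rewrite mono_deg.
  by apply/ffunP => i; rewrite !ffunE; ring.
rewrite !fdegD !fdeg_mvar !unsegre_mono_deg.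
under eq_bigr do rewrite mono_deg.
under [in RHS]eq_bigr do rewrite mono_deg.
by rewrite addnC.
Qed.

Lemma toric_locus_same x x' :
  same_point x x' -> X x -> X x'.
Proof.
move=> [t [t0 xE]] [px h]; split=> [d|m m' hw hd].
  by have [v [vd xv]] := px d; exists v; rewrite xE mulf_neq0.
have e m0 : monv x' m0 = (\prod_d t d ^+ deg m0 d) * monv x m0.
  rewrite /monv (eq_bigr (fun v => t (fac v) ^+ mult m0 v * x v ^+ mult m0 v)).
    rewrite big_split /=; congr (_ * _).
    rewrite (partition_big (@fac P) predT) //=; apply: eq_bigr => d _.
    by rewrite -prodrXr; apply: eq_bigr => v /eqP ->.
  by move=> v _; rewrite xE exprMn.
by rewrite !e (h m m') //; under eq_bigr do rewrite hd.
Qed.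

Lemma segre_regular : regular_map X Y segre.
Proof.
split=> [x|x hx]; first exact: segre_locus.
exists (1 : {mpoly C[#|coord P|]}), (fun v => 'X_[mono v]), (fun _ => delta).
split.
- exists (fun=> 0%N) => m; rewrite msupp1 inE => /eqP -> d.
  exact: (fdeg0 (@fac P)).
- by rewrite /evalp meval1 oner_neq0.
- move=> v m; rewrite msuppX inE => /eqP -> d; exact: mono_deg.
move=> y hy _.
have -> : (fun w : V => evalp (P := P) 'X_[mono w] y) = segre y.
  by apply: funext => v; rewrite evalpX.
split; first exact: (segre_locus hy).1.
by exists (fun=> 1); split=> [_|v]; rewrite ?oner_neq0 ?mul1r.
Qed.

Lemma unsegre_regular :
  regular_map Y X unsegre.
Proof.
split=> [y hy|y hy]; have [v0 y0] := toric_locus_point hy.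
  exact: toric_locus_same (unsegreE hy y0) (unsegre_at_locus hy y0).
exists ('X_[mvar (v0 : coord Q)] : {mpoly C[#|coord Q|]}).
exists (fun v => 'X_[mvar (cls (swap v0 v) : coord Q)]), (fun _ _ => 1%N); split.
- by eexists; exact: has_multidegreeX.
- by rewrite evalpX monv_mvar.
- move=> v m; rewrite msuppX inE => /eqP -> d.
  by have := fdeg_mvar (@fac Q) (cls (swap v0 v)) d; case: d.
move=> z hz; rewrite evalpX monv_mvar => z0.
have -> : (fun w => evalp (P := Q) 'X_[mvar (cls (swap v0 w))] z) = unsegre_at v0 z.
  by apply: funext => v; rewrite evalpX monv_mvar.
by split; [exact: (unsegre_at_locus hz z0).1 | exact: unsegreE].
Qed.

Lemma toric_locus_isomorphic :
  isomorphic X Y.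
Proof.
exists segre, unsegre; split.
- exact: segre_regular.
- exact: unsegre_regular.
- exact: segreK.
- exact: unsegreK.
Qed.

End ToricIsomorphism.

(** * Very ampleness and a criterion for toric degenerations *)

Section Splitting.
Variables (V D : finType) (fac : V -> D).
Implicit Types c : 'X_{1..#|V|}.

(** The source of integer decomposition: a monomial of multidegree [N.+1 * delta] splits off a
    factor of multidegree [delta]. *)
Lemma fdeg_split (alpha : D -> nat) c :
  (forall d, (alpha d <= fdeg fac c d)%N) ->
  exists2 c1 : 'X_{1..#|V|}, (c1 <= c)%MM & forall d, fdeg fac c1 d = alpha d.
Proof.
move eqk : (\sum_d alpha d)%N => k.
elim: k alpha c eqk => [|k IH] alpha c eqk hc.
  exists 0%MM; first by apply/mnm_lepP => i; rewrite mnm0E.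
  move=> d; rewrite fdeg0; move/eqP: eqk.
  by rewrite sum_nat_eq0 => /forallP/(_ d)/eqP.
have [d ad] : exists d, (0 < alpha d)%N.
  apply/existsP; apply: contraT => /existsPn H; move: eqk.
  by rewrite big1 // => d _; apply/eqP; rewrite -leqn0 leqNgt H.
have [v [vd cv]] := fdeg_gt0 (leq_trans ad (hc d)).
pose beta e := (alpha e - (d == e))%N.
have alphaE e : alpha e = (beta e + (d == e))%N.
  by rewrite subnK //; case: eqP => // <-.
have cE := mvar_le cv.
have [||c1 le1 d1] := IH beta (c - mvar v)%MM.
- apply: succn_inj; rewrite -eqk (eq_bigr _ (fun e _ => alphaE e)) big_split /=.
  rewrite -addn1; congr (_ + _)%N; rewrite (bigD1 d) //= eqxx big1 // => e.
  by rewrite eq_sym => /negbTE ->.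
- by move=> e; have := hc e; rewrite -{1}cE fdegD fdeg_mvar vd alphaE leq_add2r.
exists (c1 + mvar v)%MM.
  rewrite -cE; apply/mnm_lepP => i; rewrite !mnmDE leq_add2r.
  exact: (mnm_lepP le1).
by move=> e; rewrite fdegD fdeg_mvar vd d1 -alphaE.
Qed.

Lemma mdeg_fdeg c : mdeg c = (\sum_d fdeg fac c d)%N.
Proof.
transitivity (\sum_v mult c v)%N; last exact: (partition_big fac predT).
rewrite mdegE.
rewrite (reindex (@enum_rank V)) //=.
by exists enum_val => i _; rewrite ?enum_valK ?enum_rankK.
Qed.

End Splitting.

Section Criterion.
Variables (R : realType) (C : numFieldType) (P : multiproj) (I K : finType).
Variables (J : coord_ring C P -> Prop) (E : coord P -> {ffun K -> int}).
Variables (F : coord P -> {ffun I -> int}) (delta : factor P -> nat).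
Variables (Q : {ffun I -> R} -> Prop) (QZ : nat -> {ffun I -> int} -> Prop).

Local Notation deg := (fdeg (@fac P)).
Local Notation mon := 'X_{1..#|coord P|}.

Hypothesis fac_surj : forall d : factor P, exists v : coord P, fac v = d.
Hypothesis delta_gt0 : forall d, (0 < delta d)%N.
Hypothesis JE : forall p, J p <-> torus_vanishing E p.
Hypothesis E_deg : forall m m' : mon, wt E m = wt E m' ->
  forall d, deg m d = deg m' d.
Hypothesis EF : forall m m' : mon, (forall d, deg m d = deg m' d) ->
  (wt E m = wt E m' <-> wt F m = wt F m').
Hypothesis QZ_real : forall m, Q (real_point R m) <-> QZ 1 m.
Hypothesis QZ_wt : forall N m, QZ N m <->
  exists2 c : mon, (forall d, deg c d = N * delta d)%N & m = wt F c.
Hypothesis QZ_div : forall N c m, (0 < c)%N -> QZ (c * N) (m *+ c) -> QZ N m.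

(** The finite type ['X_{1..k < bound}] has a strict degree bound, hence the successor. *)
Let bound := (\sum_d delta d).+1%N.

Definition multidegree_weights : {fset {ffun I -> int}} :=
  seq_fset tt (map (fun m : 'X_{1..#|coord P| < bound} => wt F (bmnm m))
    (filter (fun m : 'X_{1..#|coord P| < bound} =>
               [forall d, deg (bmnm m) d == delta d]) (enum predT))).

Local Notation M := multidegree_weights.

Lemma multidegree_weightsP m : reflect
  (exists2 c : mon, (forall d, deg c d = delta d) & m = wt F c) (m \in M).
Proof.
rewrite seq_fsetE; apply: (iffP mapP) => [[c]|[c cd ->]].
  by rewrite mem_filter => /andP[/forallP h _] ->; exists c => // d; apply/eqP.
have cb : (mdeg c < bound)%N.
  by rewrite (mdeg_fdeg (@fac P)) (eq_bigr _ (fun d _ => cd d)).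
exists (BMultinom cb) => //; rewrite mem_filter mem_enum andbT.
by apply/forallP => d /=; rewrite cd.
Qed.

Lemma QZD N N' m m' : QZ N m -> QZ N' m' -> QZ (N + N') (m + m').
Proof.
move=> /QZ_wt [c hc ->] /QZ_wt [c' hc' ->]; apply/QZ_wt.
by exists (c + c')%MM; rewrite ?wtD // => d; rewrite fdegD hc hc' mulnDl.
Qed.

Lemma QZ0 : QZ 0 0.
Proof. by apply/QZ_wt; exists 0%MM; rewrite ?wt0 // => d; rewrite fdeg0. Qed.

Lemma QZMn N m : QZ 1 m -> QZ N (m *+ N).
Proof.
move=> h; elim: N => [|N IH]; first exact: QZ0.
by rewrite mulrS -add1n; apply: QZD.
Qed.

Lemma QZ_M m : m \in M <-> QZ 1 m.
Proof.
split=> [/multidegree_weightsP|/QZ_wt] [c hc ->].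
  by apply/QZ_wt; exists c => // d; rewrite mul1n.
by apply/multidegree_weightsP; exists c => // d; rewrite hc mul1n.
Qed.

Lemma in_semigroup0 v : in_semigroup M v 0.
Proof. by exists (fun=> 0%N); rewrite big1 // => m _; rewrite mulr0n. Qed.

Lemma in_semigroupD v u u' :
  in_semigroup M v u -> in_semigroup M v u' -> in_semigroup M v (u + u').
Proof.
move=> [c ->] [c' ->]; exists (fun m => c m + c' m)%N.
by rewrite -big_split; apply: eq_bigr => m _; rewrite mulrnDr.
Qed.

Lemma in_semigroup_sub v m : m \in M -> in_semigroup M v (m - v).
Proof.
move=> mM; exists (fun m' => (m' == m) : nat).
rewrite (bigD1_seq m) ?fset_uniq //= eqxx big1 ?addr0 // => e /negbTE ->.
by rewrite mulr0n.
Qed.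

Lemma in_semigroup_wt v N c : (forall d, deg c d = N * delta d)%N ->
  in_semigroup M v (wt F c - v *+ N).
Proof.
elim: N c => [|N IH] c hc.
  suff -> : c = 0%MM by rewrite wt0 mulr0n subr0; exact: in_semigroup0.
  apply/eqP; rewrite -mdeg_eq0 (mdeg_fdeg (@fac P)) sum_nat_eq0.
  by apply/forallP => d; rewrite hc.
have [d|c1 le1 d1] := @fdeg_split _ _ (@fac P) delta c.
  by rewrite hc leq_pmull.
have cE : (c - c1 + c1)%MM = c by exact: submK.
have -> : wt F c - v *+ N.+1 = (wt F c1 - v) + (wt F (c - c1)%MM - v *+ N).
  rewrite -{1}cE wtD mulrS; apply/ffunP => i; rewrite !ffunE; ring.
apply: in_semigroupD.
  by apply: in_semigroup_sub; apply/multidegree_weightsP; exists c1.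
apply: IH => d; apply: (@addIn (deg c1 d)).
by rewrite -fdegD cE hc d1 mulSn addnC.
Qed.

Lemma multidegree_weights_very_ample Q' : very_ample (R := R) Q' M.
Proof.
move=> v vM _ u c c0 [k uk].
(* If [u *+ c] is a sum of [N] differences [m - v], then [(u + v *+ N) *+ c] is a sum of [c * N]
   points of [M]. Dividing by [c] puts [u + v *+ N] in the [N]-th dilate, where it decomposes into
   [N] points of [M]. *)
pose N := (\sum_(m <- M) k m)%N.
suff /QZ_wt [c' hc' e] : QZ N (u + v *+ N).
  by have := in_semigroup_wt v hc'; rewrite -e addrK.
apply: (QZ_div c0).
have -> : (u + v *+ N) *+ c = \sum_(m <- M) m *+ k m + v *+ (c.-1 * N).
  have -> : \sum_(m <- M) m *+ k m = u *+ c + v *+ N.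
    rewrite uk /N -sumrMnr -big_split; apply: eq_bigr => m _ /=.
    by rewrite mulrnBl subrK.
  rewrite mulrnDl -mulrnA -addrA -mulrnDr -mulSn (prednK c0) mulnC.
  by [].
have -> : (c * N)%N = (N + c.-1 * N)%N by rewrite -mulSn prednK.
apply: QZD; last exact/QZMn/QZ_M.
rewrite /N big_seq [X in QZ _ X]big_seq.
elim/big_rec2: _ => [|m m' N' mM IH]; first exact: QZ0.
by apply: QZD => //; exact/QZMn/QZ_M.
Qed.

(** [QZ N] stands for the lattice points of the [N]-th dilate of [Q]. They are weights of monomials
    by [QZ_wt] and saturated by [QZ_div], which makes [Q] very ample, so the dilation factor 1
    serves. [E] describes the ideal and [F] the polytope; [EF] says that they have the same classes
    within a multidegree. *)
Lemma toric_variety_criterion : is_toric_variety_of Q J.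
Proof.
exists 1%N, M; split=> //.
- move=> m; rewrite QZ_M -QZ_real; split=> [h|[T hT ->] //].
  by exists (real_point R m).
- exact: multidegree_weights_very_ample.
split; first exact: torus_vanishing_reduced fac_surj JE.
pose V : finType := fset_sub_type M; pose EV (v : V) := val v.
have /choice [mono monoP] (v : V) : exists c : mon,
    (forall d, deg c d = delta d) /\ wt F c = EV v.
  by have /multidegree_weightsP [c hc e] := valP v; exists c.
have /choice [cls clsP] (m : mon) : exists v : V,
    (forall d, deg m d = delta d) -> EV v = wt F m.
  have [h|h] := pselect (forall d, deg m d = delta d).
    have mM : wt F m \in M by apply/multidegree_weightsP; exists m.
    by exists [` mM]%fset.
  (* For [m] of another multidegree [cls m] is arbitrary, but some element of [M] has to be
     exhibited. *)
  have [s sP] := choice fac_surj.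
  pose c := (\big[+%MM/0%MM]_d (mvar (s d) *+ delta d)%MM : mon).
  have cM : wt F c \in M.
    apply/multidegree_weightsP; exists c => // d.
    rewrite fdeg_sum (bigD1 d) //= fdegMn fdeg_mvar sP eqxx mul1n.
    by rewrite big1 ?addn0 // => e /negbTE ed; rewrite fdegMn fdeg_mvar sP ed.
  by exists [` cM]%fset.
have /choice [sel selP] (vd : V * factor P) : exists w : coord P,
    fac w = vd.2 /\ (0 < mult (mono vd.1) w)%N.
  by apply: fdeg_gt0; rewrite (monoP vd.1).1.
have [phi [psi [h1 h2 h3 h4]]] := @toric_locus_isomorphic C P I F V EV delta
  val_inj mono (fun v => (monoP v).1) (fun v => (monoP v).2) cls clsP
  (fun v d => sel (v, d)) (fun v d => (selP (v, d)).1) (fun v d => (selP (v, d)).2).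
have JF x : zero_locus J x <-> toric_locus F x.
  rewrite (zero_locus_torus_vanishing JE E_deg).
  by split=> -[px h]; split=> // m m' hw hd; apply: h => //; apply/EF.
have YF y : projective_toric_variety C I M y <->
    toric_locus (P := proj_space (fset_sub_type M)) EV y.
  apply: toric_closureP => x; split=> -[t [t0 h]]; exists t; split=> //.
have -> : zero_locus J = toric_locus F.
  by apply: funext => x; apply: propext.
have -> : projective_toric_variety C I M =
    toric_locus (P := proj_space (fset_sub_type M)) EV.
  by apply: funext => x; apply: propext.
by exists phi, psi.
Qed.

End Criterion.

(** * Standard monomials *)

Section Counting.
Variable n : nat.
Local Notation V := (plucker_index n).
Implicit Types (v w : V) (m : 'X_{1..#|V|}).

(** Columns are handled through this function: the [i]-th smallest element of [v], counted from 1,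
    is [< j] exactly when [i <= cnt v j], so that positions become inequalities. *)
Definition cnt v (j : nat) : nat := #|[set r in val v | (r < j)%N]|.

Lemma card_below0 (B : {set 'I_n}) : #|[set r in B | (r < 0)%N]| = 0%N.
Proof. by apply: eq_card0 => r; rewrite inE andbF. Qed.

Lemma card_belowS (B : {set 'I_n}) (s : 'I_n) :
  #|[set r in B | (r < s.+1)%N]| = (#|[set r in B | (r < s)%N]| + (s \in B))%N.
Proof.
case: (boolP (s \in B)) => sv.
  rewrite (cardsD1 s) inE sv ltnS leqnn addnC; congr (_ + _)%N.
  apply: eq_card => r; rewrite !inE ltnS -val_eqE /= [in LHS]leq_eqVlt.
  by case: ltngtP; rewrite ?andbF ?andbT.
rewrite addn0; apply: eq_card => r; rewrite !inE ltnS leq_eqVlt.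
by case: eqP => //= /val_inj ->; rewrite (negbTE sv).
Qed.

Lemma cnt0 v : cnt v 0 = 0%N.
Proof. exact: card_below0. Qed.

Lemma cntS v (s : 'I_n) : cnt v s.+1 = (cnt v s + (s \in val v))%N.
Proof. exact: card_belowS. Qed.

Lemma cnt_large v j : (n <= j)%N -> cnt v j = #|val v|.
Proof.
by move=> h; apply: eq_card => r; rewrite !inE (leq_trans _ h) // andbT.
Qed.

Lemma cnt_le_succ v j : (cnt v j <= cnt v j.+1)%N.
Proof.
apply: subset_leq_card; apply/subsetP => r; rewrite !inE => /andP[-> h] /=.
exact: ltnW.
Qed.

Lemma cnt_succ_le v j : (cnt v j.+1 <= (cnt v j).+1)%N.
Proof.
have [h|h] := ltnP j n; last by rewrite !cnt_large // ltnW.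
by rewrite (cntS v (Ordinal h)) -[leqRHS]addn1 leq_add2l leq_b1.
Qed.

Lemma cnt_le v j : (cnt v j <= j)%N.
Proof.
by elim: j => [|j IH]; rewrite ?cnt0 // (leq_trans (cnt_succ_le v j)).
Qed.

Lemma cnt_le_card v j : (cnt v j <= #|val v|)%N.
Proof. by apply: subset_leq_card; apply/subsetP => r; rewrite inE => /andP[]. Qed.

Lemma cnt_lt v (s : 'I_n) : (cnt v s < n)%N.
Proof. exact: leq_ltn_trans (cnt_le v s) _. Qed.

Lemma cnt_inj v w : (forall j, (j <= n)%N -> cnt v j = cnt w j) -> v = w.
Proof.
move=> h; apply: val_inj; apply/setP => s.
have := h s.+1 (ltn_ord s); rewrite !cntS h; last exact: ltnW.
by move/addnI; case: (s \in val v); case: (s \in val w).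
Qed.

Lemma plucker_card v : (0 < #|val v| < n)%N.
Proof. exact: valP v. Qed.

Lemma enum_val_incr (A : {set 'I_n}) (r r' : 'I_#|A|) :
  (r < r')%N -> (enum_val r < enum_val r')%N.
Proof.
move=> h; have x0 := enum_val r.
have srt : sorted ltn (map val (enum A)).
  rewrite /enum_mem -enumT sorted_map; apply: sorted_filter.
    by move=> y x z; exact: ltn_trans.
  by rewrite -sorted_map val_enum_ord iota_ltn_sorted.
have sz (k : 'I_#|A|) : (k < size (enum A))%N by rewrite -cardE.
rewrite !(enum_val_nth x0) -!(nth_map x0 0%N val) //.
by apply: (sorted_ltn_nth ltn_trans 0%N srt) => //; rewrite inE size_map.
Qed.

(** It places the diagonal term of every minor on or below the diagonal of the matrix, the part
    where [curve] is nonzero. *)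
Lemma leq_enum_val (A : {set 'I_n}) (r : 'I_#|A|) : (r <= enum_val r)%N.
Proof.
case: r => k hk /=; elim: k hk => // k IH hk.
apply: leq_ltn_trans (IH (ltnW hk)) _.
exact: enum_val_incr.
Qed.

Lemma cnt_enum_val v (r : 'I_#|val v|) : cnt v (enum_val r) = r.
Proof.
rewrite /cnt (_ : [set _ in _ | _] = [set enum_val s | s : 'I_#|val v| & (s < r)%N]).
  rewrite card_imset; last exact: enum_val_inj.
  have := ltnW (ltn_ord r); move: (nat_of_ord r) => k kn.
  have -> : [set s : 'I_#|val v| | (s < k)%N] = [set widen_ord kn s | s : 'I_k].
    apply/setP => s; rewrite inE; apply/idP/imsetP => [h|[s0 _ ->]]; last exact: (valP s0).
    by exists (Ordinal h) => //; apply: val_inj.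
  rewrite card_imset ?card_ord // => s s' /(congr1 val) h; exact: val_inj.
apply/setP => s; rewrite !inE; apply/andP/imsetP => [[sv h]|[k]].
  exists (enum_rank_in sv s); last by rewrite enum_rankK_in.
  rewrite inE ltnNge; apply: contraTN h => h; rewrite -leqNgt.
  rewrite -[s in X in (_ <= X)%N](enum_rankK_in sv sv); move: h; rewrite leq_eqVlt.
  by case/predU1P => [/val_inj <- //|/enum_val_incr/ltnW].
by rewrite inE => h ->; split; [exact: enum_valP | exact: enum_val_incr].
Qed.

(* The exponents of the diagonal term of the minor [v]; variables are indexed by
   (column, row). *)
Definition diag_exp v : {ffun 'I_n * 'I_n -> int} :=
  [ffun p : 'I_n * 'I_n => ((p.2 \in val v) && (cnt v p.2 == p.1 :> nat) : nat)%:Z].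

Lemma charv_diag_exp (C : fieldType) (t : 'I_n * 'I_n -> C) v :
  charv t (diag_exp v) =
  \prod_(r < #|val v|) t (widen_ord (plucker_size_subproof v) r, enum_val r).
Proof.
transitivity (\prod_(s in val v) t (Ordinal (cnt_lt v s), s)); last first.
  rewrite big_enum_val; apply: eq_bigr => r _; congr t; congr (_, _).
  by apply: val_inj; rewrite /= cnt_enum_val.
transitivity (\prod_l \prod_s t (l, s) ^ diag_exp v (l, s)).
  by rewrite pair_bigA; apply: eq_bigr => -[l s].
rewrite exchange_big [RHS]big_mkcond; apply: eq_bigr => s _.
rewrite (bigD1 (Ordinal (cnt_lt v s))) //= big1 ?mulr1.
  by rewrite ffunE /= eqxx andbT; case: ifP; rewrite ?expr1z ?expr0z.
move=> l hl; rewrite ffunE /= (_ : _ == _ = false) ?andbF ?expr0z //.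
by apply: contraNF hl => /eqP h; apply/eqP/val_inj.
Qed.

(* The number of entries [<= j] in row [i] of the tableau with the columns [m]. *)
Definition row_count m i j : int := wt (fun v => ((i <= cnt v j)%N : nat)%:Z) m.

Lemma rowD m m' i j : row_count (m + m')%MM i j = row_count m i j + row_count m' i j.
Proof. exact: wtD. Qed.

Lemma row_mvar v i j : row_count (mvar v) i j = (i <= cnt v j)%N.
Proof. exact: wt_mvar. Qed.

Lemma row_neq0P m i j :
  reflect (exists2 v, (0 < mult m v)%N & (i <= cnt v j)%N) (row_count m i j != 0).
Proof.
have ge0 v : true -> 0 <= ((i <= cnt v j)%N : nat)%:Z *+ mult m v.
  by move=> _; rewrite mulrn_wge0.
apply: (iffP idP) => [|[v v0 vij]].
  apply: contra_neqP => H; rewrite /row_count /wt big1 // => v _.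
  have [h|] := leqP i (cnt v j); last by rewrite mul0rn.
  by case: (posnP (mult m v)) => [->|mv]; [rewrite mulr0n | case: H; exists v].
apply/eqP => /(psumr_eq0P ge0)/(_ v isT)/eqP.
by rewrite vij mulrn_eq0 orbF eqn0Ngt v0.
Qed.

(** The exponent at [(l, s)] counts the entries [s + 1] in row [l + 1] of the tableau, which is the
    increment of the row count. *)
Lemma row_diag_exp m (l s : 'I_n) :
  row_count m l.+1 s.+1 = row_count m l.+1 s + wt diag_exp m (l, s).
Proof.
rewrite wt_ffunE /row_count /wt -big_split; apply: eq_bigr => v _ /=.
rewrite -mulrnDl; congr (_ *+ _); rewrite ffunE cntS /=.
case: (s \in val v); rewrite /= ?addn0 ?addn1 ?addr0 // ltnS leq_eqVlt eq_sym.
by rewrite -PoszD; congr Posz; case: ltngtP.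
Qed.

Lemma row0 m i : row_count m i.+1 0 = 0.
Proof. by rewrite /row_count /wt big1 // => v _; rewrite cnt0 mul0rn. Qed.

Lemma row_big m i j : (j < i)%N -> row_count m i j = 0.
Proof.
move=> h; rewrite /row_count /wt big1 // => v _.
by rewrite leqNgt (leq_ltn_trans (cnt_le v j) h) mul0rn.
Qed.

Lemma diag_exp_row m m' :
  (wt diag_exp m = wt diag_exp m') <->
  (forall i j, (0 < i)%N -> (j <= n)%N -> row_count m i j = row_count m' i j).
Proof.
split=> [h [//|i] j _|h]; last first.
  apply/ffunP => -[l s]; apply: (addrI (row_count m l.+1 s)).
  by rewrite -row_diag_exp !h // ?row_diag_exp // ltnW.
elim: j => [|j IH] jn; first by rewrite !row0.
have [ni|ni] := ltnP i n; last by rewrite !row_big // ltnS (leq_trans jn).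
rewrite (row_diag_exp m (Ordinal ni) (Ordinal jn)).
by rewrite (row_diag_exp m' (Ordinal ni) (Ordinal jn)) /= h IH // ltnW.
Qed.

Local Notation deg := (fdeg (@fac (plucker_space n))).

Lemma deg_row m d : (deg m d)%:Z = row_count m d.+1 n - row_count m d.+2 n.
Proof.
rewrite /row_count /wt -sumrB /fdeg (big_morph Posz PoszD (erefl : Posz 0 = 0)).
rewrite big_mkcond /=.
apply: eq_bigr => v _; rewrite -mulrnBl cnt_large //.
have /andP[v0 _] := plucker_card v.
have -> : (Ordinal (plucker_factor_subproof v) == d) = (#|val v| == d.+1).
  by rewrite -val_eqE /= -[in RHS](prednK v0) eqSS.
case: (ltngtP #|val v| d.+1) => _ /=; rewrite ?subrr ?mul0rn // subr0.
exact: (esym (natz _)).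
Qed.

Lemma diag_exp_deg m m' : wt diag_exp m = wt diag_exp m' ->
  forall d, deg m d = deg m' d.
Proof.
move=> /diag_exp_row h d; apply/eqP; rewrite -eqz_nat !deg_row !h //.
Qed.

(* As columns of a tableau, [v] may stand to the left of [w]. *)
Definition cnt_ge v w : bool := [forall j : 'I_n.+1, (cnt w j <= cnt v j)%N].

Lemma cnt_geP v w :
  reflect (forall j, (cnt w j <= cnt v j)%N) (cnt_ge v w).
Proof.
apply: (iffP forallP) => [h j|h j]; last exact: h.
have [jn|jn] := leqP j n; first exact: (h (Ordinal (jn : (j < n.+1)%N))).
by have := h ord_max; rewrite /= !(cnt_large _ (ltnW jn)) !cnt_large.
Qed.

Definition standard m : Prop :=
  forall v w, (0 < mult m v)%N -> (0 < mult m w)%N -> cnt_ge v w || cnt_ge w v.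

(** Among pairwise comparable columns, one that maximizes the sum of its counts is the greatest. *)
Lemma standard_top m : standard m -> m != 0%MM ->
  exists2 v, (0 < mult m v)%N &
    forall w, (0 < mult m w)%N -> forall j, (cnt w j <= cnt v j)%N.
Proof.
move=> sm m0; pose f v := (\sum_(j < n.+1) cnt v j)%N.
have [v0 mv0] : exists v, (0 < mult m v)%N.
  apply/existsP; apply: contraNT m0 => /existsPn H; apply/eqP/multP => v.
  by apply/eqP; rewrite mult0 eqn0Ngt H.
case: (@arg_maxnP V v0 (fun v => (0 < mult m v)%N) f mv0) => v mv vmax; exists v => // w mw.
apply/cnt_geP; case/orP: (sm v w mv mw) => // wv.
apply/forallP => j; apply/contraT; rewrite -ltnNge => lt.
have := vmax w mw; rewrite /geq /= leqNgt => /negP[]; rewrite /f.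
rewrite (bigD1 j) //= [ltnRHS](bigD1 j) //= -addSn leq_add //.
by apply: leq_sum => k _; have /forallP := wv.
Qed.

(** The leftmost column can be read off: [cnt v j] is the largest [i > 0] with a nonzero row count
    at [(i, j)], or 0 if there is none. Removing it lowers the degree. *)
Lemma standard_unique m m' : standard m -> standard m' ->
  (forall i j, (0 < i)%N -> (j <= n)%N -> row_count m i j = row_count m' i j) -> m = m'.
Proof.
move eqk : (mdeg m) => k; elim: k m m' eqk => [|k IH] m m' eqk sm sm' h.
  have m0 : m = 0%MM by apply/eqP; rewrite -mdeg_eq0 eqk.
  rewrite m0; apply/esym/eqP; apply: contraT => m'0; have [v mv _] := standard_top sm' m'0.
  have /row_neq0P : exists2 v, (0 < mult m' v)%N & (1 <= cnt v n)%N.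
    by exists v => //; rewrite cnt_large //; case/andP: (plucker_card v).
  by rewrite -h // m0 /row_count wt0.
have m0 : m != 0%MM by rewrite -mdeg_eq0 eqk.
have [v mv vtop] := standard_top sm m0.
have m'0 : m' != 0%MM.
  apply: contraNneq m0 => m'0.
  have /row_neq0P : exists2 v, (0 < mult m v)%N & (1 <= cnt v n)%N.
    by exists v => //; rewrite cnt_large //; case/andP: (plucker_card v).
  by rewrite h // m'0 /row_count wt0.
have [v' mv' v'top] := standard_top sm' m'0.
have le w w' (m1 m2 : 'X_{1..#|V|}) : (0 < mult m1 w)%N ->
    (forall u, (0 < mult m2 u)%N -> forall j, (cnt u j <= cnt w' j)%N) ->
    (forall i j, (0 < i)%N -> (j <= n)%N -> row_count m1 i j = row_count m2 i j) ->
    forall j, (j <= n)%N -> (cnt w j <= cnt w' j)%N.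
  move=> mw top hr j jn; case: (posnP (cnt w j)) => [-> //|c0].
  have /row_neq0P : exists2 u, (0 < mult m1 u)%N & (cnt w j <= cnt u j)%N by exists w.
  by rewrite hr // => /row_neq0P [u mu /leq_trans]; apply; apply: top.
have vv' : v = v'.
  apply: cnt_inj => j jn; apply/eqP; rewrite eqn_leq.
  rewrite (le _ _ _ _ mv v'top h) // (le _ _ _ _ mv' vtop) // => i j' *.
  by rewrite h.
subst v'; rewrite -(mvar_le mv) -(mvar_le mv'); congr (_ + _)%MM.
have sub (m1 : 'X_{1..#|V|}) : standard m1 -> standard (m1 - mvar v)%MM.
  by move=> s1 u w; rewrite !multB => hu hw; apply: s1; apply: leq_trans (leq_subr _ _); eassumption.
apply: IH; try exact: sub.
  apply: succn_inj; rewrite -eqk -[in RHS](mvar_le mv) mdegD mdeg1 addn1.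
  by [].
move=> i j i0 jn; apply: (addIr (row_count (mvar v) i j)).
by rewrite -!rowD !mvar_le // h.
Qed.

End Counting.

(** * The lowest term of a minor *)

(** Pairs that are not indices are covered, both sides being 0 there; in particular the diagonal of
    [A] counts as 0. *)
Lemma entry_sum (n : nat) (A : theta int n) i j : (i <= n)%N -> (j <= n)%N ->
  entry A i j =
  \sum_p A p *+ (((val p).1 == i :> nat) && ((val p).2 == j :> nat)).
Proof.
move=> hi hj; rewrite /entry; case: insubP => [p _ pE|].
  rewrite (bigD1 p) //= pE !inordK // !eqxx big1 ?addr0 // => q qp.
  case: andP => [[/eqP q1 /eqP q2]|]; last by rewrite mulr0n.
  case/negP: qp; apply/eqP/val_inj; rewrite pE -q1 -q2 !inord_val.
  exact: surjective_pairing.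
rewrite !inordK //= => H; rewrite big1 // => p _.
case: andP => [[/eqP h1 /eqP h2]|]; last by rewrite mulr0n.
by case/negP: H; rewrite -h1 -h2; exact: (valP p).
Qed.

Lemma entry_theta (K : nmodType) (n : nat) (T : theta K n) (p : theta_index n) :
  entry T (val p).1 (val p).2 = T p.
Proof.
rewrite /entry !inord_val; case: insubP => [q _ qE|].
  by congr (T _); apply: val_inj; rewrite qE [RHS]surjective_pairing.
by case/negP; exact: (valP p).
Qed.

Lemma nth_indices (n : nat) (v : plucker_index n) (r : 'I_#|val v|) :
  nth 0%N (indices v) r = (enum_val r).+1.
Proof.
rewrite (nth_map (enum_val r)) -?cardE ?ltn_ord //.
by rewrite -enum_val_nth.
Qed.

Lemma size_indices (n : nat) (v : plucker_index n) : size (indices v) = #|val v|.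
Proof. by rewrite size_map -cardE. Qed.

Lemma sigma_entry (n : nat) (A : theta int n) (v : plucker_index n) :
  sigma A v = \sum_(r < #|val v|) entry A r.+1 (enum_val r).+1.
Proof.
have eA (r : 'I_#|val v|) : entry A r.+1 (enum_val r).+1 =
    \sum_p A p *+ (((val p).1 == r.+1 :> nat) && ((val p).2 == (enum_val r).+1 :> nat)).
  by rewrite entry_sum // (leq_trans (ltn_ord r)) // plucker_size_subproof.
rewrite (eq_bigr _ (fun r _ => eA r)) exchange_big /sigma.
apply: eq_bigr => p _ /=.
rewrite ffunE size_indices /=.
have /andP[p1 _] := valP p.
case: ifP => [/andP[le /eqP e]|H].
  have lt : ((val p).1.-1 < #|val v|)%N by rewrite prednK.
  rewrite (bigD1 (Ordinal lt)) //= -(nth_indices (Ordinal lt)) /= e prednK //.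
  rewrite !eqxx big1 ?addr0 ?mulr1 // => r rlt.
  rewrite (_ : _ == _ = false) //; apply: contraNF rlt => /eqP h.
  by apply/eqP/val_inj; rewrite /= h.
rewrite mulr0 big1 // => r _; case: andP => //= -[/eqP h1 /eqP h2].
by move: H; rewrite h1 /= nth_indices h2 eqxx ltn_ord.
Qed.

Lemma ltr_succ_homo (n : nat) (f : nat -> int) :
  (forall i, (i.+1 < n)%N -> f i < f i.+1) ->
  forall i j, (i < j)%N -> (j < n)%N -> f i < f j.
Proof.
move=> h i; elim=> // j IH; rewrite ltnS leq_eqVlt => /predU1P[->|ij] jn.
  exact: h.
exact: lt_trans (IH ij (ltnW jn)) (h _ jn).
Qed.

(** The first moved point [r] is sent to the right, and what is sent to [r] comes from the right. *)
Lemma perm_inversion (k : nat) (s : {perm 'I_k}) : s != 1%g ->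
  exists r r' : 'I_k, (r < r')%N /\ (s r' < s r)%N.
Proof.
move=> s1; have [r0 sr0] : exists r, s r != r.
  apply/existsP; apply: contraNT s1 => /existsPn H; apply/eqP/permP => r.
  by rewrite perm1; apply/eqP; move: (H r); rewrite negbK.
case: (@arg_minnP _ r0 (fun r => s r != r) (@nat_of_ord k) sr0) => r sr rmin.
have low (x : 'I_k) : (x < r)%N -> s x = x.
  by move=> xr; apply/eqP; apply: contraTT xr => /rmin; rewrite -leqNgt.
have lt_r : (r < s r)%N.
  rewrite ltn_neqAle; apply/andP; split; first by apply: contraNneq sr => /val_inj <-.
  rewrite leqNgt; apply/negP => h; move: (low _ h) => /perm_inj e.
  by case/eqP: sr.
have sK : s ((s^-1)%g r) = r by rewrite permKV.
exists r, ((s^-1)%g r); rewrite sK; split=> //.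
rewrite ltn_neqAle; apply/andP; split.
  by apply: contraNneq sr => /val_inj h; rewrite {1}h sK.
rewrite leqNgt; apply/negP => h; have := low _ h; rewrite sK => e.
by move: h; rewrite -e ltnn.
Qed.

(** Undoing an inversion strictly lowers the sum by the Monge inequality, so a minimizer has no
    inversion: it is the identity, and it is the only one. *)
Lemma strict_rearrangement (n k : nat) (w : nat -> nat -> int) (f : 'I_k -> nat)
    (s : {perm 'I_k}) :
  (k <= n)%N ->
  (forall i i' j j', (i < i' < n)%N -> (j < j' < n)%N ->
     w i j + w i' j' < w i' j + w i j') ->
  (forall r, (f r < n)%N) -> (forall r r' : 'I_k, (r < r')%N -> (f r < f r')%N) ->
  s != 1%g -> \sum_r w (f r) r < \sum_r w (f r) (s r).
Proof.
move=> kn monge fn fincr.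
pose W (s : {perm 'I_k}) := \sum_r w (f r) (s r).
have swap (u : {perm 'I_k}) : u != 1%g -> exists u', W u' < W u.
  case/perm_inversion => r [r' [rr' uu']]; exists (tperm r r' * u)%g.
  have ne : r' != r by apply: contraTneq rr' => ->; rewrite ltnn.
  rewrite /W (bigD1 r) //= (bigD1 r') //= [ltRHS](bigD1 r) //= [in ltRHS](bigD1 r') //=.
  rewrite !permM tpermL tpermR.
  have -> : \sum_(i < k | (i != r) && (i != r')) w (f i) ((tperm r r' * u)%g i) =
      \sum_(i < k | (i != r) && (i != r')) w (f i) (u i).
    by apply: eq_bigr => i /andP[ir ir']; rewrite permM tpermD // eq_sym.
  have := monge (f r) (f r') (u r') (u r).
  rewrite fincr // fn uu' (leq_trans (ltn_ord (u r)) kn) => /(_ isT isT).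
  lra.
move=> s1; have -> : \sum_r w (f r) r = W 1%g by apply: eq_bigr => r _; rewrite perm1.
case: (@Order.TotalTheory.arg_minP _ _ _ s predT W isT) => u _ umin.
have u1 : u = 1%g.
  by apply/eqP; apply: contraT => /swap [u']; rewrite ltNge umin.
rewrite -u1 lt_neqAle umin ?andbT //; apply/negP => /eqP e.
have [u' lt] := swap s s1; have h := le_lt_trans (umin u' isT) lt.
by case/lt_eqF/negbT/eqP: h; exact: e.
Qed.

Section LowestTerm.
Variables (C : numFieldType) (n : nat) (A : theta int n).
Hypothesis A_a : forall i : nat, (1 <= i <= n - 2)%N ->
  entry A i i.+1 + entry A i.+1 i.+2 < entry A i i.+2.
Hypothesis A_b : forall i j : nat, (1 <= i)%N -> (i < j - 1)%N ->
  (j - 1 <= n - 2)%N ->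
  entry A i j + entry A i.+1 j.+1 < entry A i j.+1 + entry A i.+1 j.

Let bound : int := \sum_p `|A p| + 1.

(* The weight of the matrix entry in row [s] and column [l].  It is only used on
   and below the diagonal; the values above make it a Monge array. *)
Definition entry_weight (s l : nat) : int :=
  if (l <= s)%N then entry A l.+1 s.+1 else bound * ((l - s) ^ 2)%N%:Z.

Lemma entry_diag i : (i <= n)%N -> entry A i i = 0.
Proof.
move=> h; rewrite entry_sum // big1 // => p _; case: andP => // -[/eqP h1 /eqP h2].
by have := valP p; rewrite /= h1 h2 ltnn andbF.
Qed.

Lemma entry_bound i j : (i <= n)%N -> (j <= n)%N -> - bound < entry A i j.
Proof.
move=> hi hj; suff : `|entry A i j| <= \sum_p `|A p| by rewrite /bound; lia.
rewrite entry_sum //; apply: le_trans (ler_norm_sum _ _ _) _.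
by apply: ler_sum => p _; case: andP => _; rewrite ?mulr1n // mulr0n normr0.
Qed.

(** Three regions. Below the diagonal this is [A_b], or [A_a] when one corner of the square is a
    diagonal entry, which is 0. Above, it is the strict convexity of the square function. Across the
    diagonal, [bound] exceeds the absolute value of every entry of [A]. *)
Lemma entry_weight_adjacent s l : (s.+1 < n)%N -> (l.+1 < n)%N ->
  entry_weight s l + entry_weight s.+1 l.+1 <
  entry_weight s.+1 l + entry_weight s l.+1.
Proof.
move=> sn ln; rewrite /entry_weight ltnS.
have b1 : 1 <= bound by rewrite /bound lerDr sumr_ge0.
case: (ltngtP l s) => [ls|sl|->].
- rewrite (leq_trans (ltnW ls) (leqnSn s)).
  have := A_a (i := s); have := A_b (i := l.+1) (j := s.+1).
  move: ls; rewrite leq_eqVlt => /predU1P[e|ls] hb ha.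
    subst s; by rewrite (entry_diag ln) addr0; apply: ha; lia.
  by apply: hb; lia.
- have -> : (l <= s.+1)%N = (l == s.+1) by lia.
  have [k lk] : exists k, l = (s.+1 + k)%N by exists (l - s.+1)%N; lia.
  case: (posnP k) => k0.
    rewrite lk k0 addn0 eqxx entry_diag // add0r; nia.
  have -> : (l == s.+1) = false by lia.
  rewrite lk; nia.
rewrite leqnSn !entry_diag //; last exact: ltnW.
have := entry_bound (ltnW sn) sn; rewrite subSnn; lia.
Qed.

(** A rectangle is made of unit squares: the adjacent inequalities are summed in one direction, then
    in the other. *)
Lemma entry_weight_monge i i' j j' : (i < i' < n)%N -> (j < j' < n)%N ->
  entry_weight i j + entry_weight i' j' < entry_weight i' j + entry_weight i j'.
Proof.
move=> /andP[ii' i'n] /andP[jj' j'n].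
suff : entry_weight i j - entry_weight i' j < entry_weight i j' - entry_weight i' j'.
  by lra.
apply: (ltr_succ_homo (n := n)
  (f := fun j => entry_weight i j - entry_weight i' j)) => // l ln.
suff : entry_weight i l - entry_weight i l.+1 < entry_weight i' l - entry_weight i' l.+1.
  by lra.
apply: (ltr_succ_homo (n := n)
  (f := fun i => entry_weight i l - entry_weight i l.+1)) => // s sn.
have := entry_weight_adjacent sn ln; lra.
Qed.

Local Notation V := (plucker_index n).

Lemma sigma_weight (v : V) :
  sigma A v = \sum_(r < #|val v|) entry_weight (enum_val r) r.
Proof.
rewrite sigma_entry; apply: eq_bigr => r _.
by rewrite /entry_weight leq_enum_val.
Qed.

Lemma sigma_lt (v : V) (s : {perm 'I_#|val v|}) : s != 1%g ->
  sigma A v < \sum_(r < #|val v|) entry_weight (enum_val r) (s r).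
Proof.
rewrite sigma_weight; apply: (strict_rearrangement (plucker_size_subproof v)
  entry_weight_monge (f := fun r => nat_of_ord (enum_val r))) => // r r'.
exact: enum_val_incr.
Qed.

Variable t : 'I_n * 'I_n -> C.
Hypothesis t_neq0 : forall p, t p != 0.

Definition curve (e : C) : 'M[C]_n :=
  \matrix_(s, l) if (l <= s)%N then e ^ entry_weight s l * t (l, s) else 0.

Lemma det_curve e : \det (curve e) = \prod_l t (l, l).
Proof.
rewrite det_trig; last first.
  by apply/is_trig_mxP => i j ij; rewrite mxE leqNgt ij.
apply: eq_bigr => l _; rewrite mxE leqnn /entry_weight leqnn entry_diag //.
by rewrite expr0z mul1r.
Qed.

(** The minor of [curve e] divided by [e ^ sigma A v]. By [sigma_lt] the exponents are nonnegative,
    so [absz] changes nothing, and only the identity has exponent 0: the value at 0 is the diagonal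
    term. *)
Definition minor_poly (v : V) : {poly C} :=
  \sum_(s : {perm 'I_#|val v|})
    ((-1) ^+ s * \prod_(r < #|val v|) (if (s r <= enum_val r)%N
       then t (widen_ord (plucker_size_subproof v) (s r), enum_val r) else 0)) *:
    'X^(absz (\sum_(r < #|val v|) entry_weight (enum_val r) (s r) - sigma A v)%R).

Lemma plucker_minor_curve (v : V) e : e != 0 ->
  plucker_minor (curve e) v = e ^ sigma A v * (minor_poly v).[e].
Proof.
move=> e0; rewrite /plucker_minor /minor_poly /determinant horner_sum mulr_sumr.
apply: eq_bigr => s _; rewrite hornerZ hornerXn.
set k := absz _.
have kE : sigma A v + k%:Z = \sum_(r < #|val v|) entry_weight (enum_val r) (s r).
  rewrite /k gez0_abs; first by rewrite addrC subrK.
  rewrite subr_ge0; have [->|/sigma_lt/ltW //] := eqVneq s 1%g.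
  by rewrite sigma_weight; apply: ler_sum => r _; rewrite perm1.
rewrite [RHS]mulrC -[in RHS]mulrA (exprnP e) -expfzDr // addrC kE.
rewrite -[RHS]mulrA; congr (_ * _).
rewrite (big_morph (fun a => e ^ a) (fun a b => expfzDr a b e0) (expr0z e)).
rewrite -big_split; apply: eq_bigr => r _; rewrite !mxE /=.
by case: ifP; rewrite ?mul0r // mulrC.
Qed.

Lemma minor_poly0 (v : V) : (minor_poly v).[0] = charv t (diag_exp v).
Proof.
rewrite /minor_poly horner_sum (bigD1 1%g) //= [X in _ + X]big1 => [|s s1].
  rewrite addr0 hornerZ odd_perm1 mul1r charv_diag_exp.
  have -> : \sum_(r < #|val v|) entry_weight (enum_val r) ((1%g : {perm 'I_#|val v|}) r) - sigma A v = 0.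
    rewrite sigma_weight; apply/eqP; rewrite subr_eq0; apply/eqP.
    by apply: eq_bigr => r _; rewrite perm1.
  rewrite hornerXn expr0 mulr1; apply: eq_bigr => r _.
  by rewrite perm1 /= leq_enum_val.
rewrite hornerZ hornerXn expr0n (_ : _ == _ = false) ?mulr0 //.
by apply/negbTE; rewrite absz_eq0 subr_eq0 gt_eqF // sigma_lt.
Qed.

End LowestTerm.

Lemma poly_vanish (C : numFieldType) (p : {poly C}) :
  (forall e, e != 0 -> p.[e] = 0) -> p = 0.
Proof.
move=> h; apply/eqP; apply: contraT => p0.
pose rs : seq C := [seq k.+1%:R | k <- iota 0 (size p)].
have := max_poly_roots p0 (rs := rs); rewrite size_map size_iota ltnn; apply.
  by apply/allP => _ /mapP[k _ ->]; apply/eqP/h; rewrite pnatr_eq0.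
rewrite map_inj_uniq ?iota_uniq // => i j /eqP.
by rewrite eqr_nat eqSS => /eqP.
Qed.

Lemma horner_monv (C : comNzRingType) (V : finType) (x : V -> {poly C}) m e :
  (monv x m).[e] = monv (fun v => (x v).[e]) m.
Proof. by rewrite /monv horner_prod; apply: eq_bigr => v _; rewrite horner_exp. Qed.

Lemma monv_expz (C : fieldType) (V : finType) (e : C) (S : V -> int) (y : V -> C) m :
  e != 0 -> monv (fun v => e ^ S v * y v) m = e ^ wt S m * monv y m.
Proof.
move=> e0; rewrite /monv /wt (big_morph (fun a => e ^ a) (fun a b => expfzDr a b e0) (expr0z e)).
rewrite -big_split; apply: eq_bigr => v _ /=; rewrite exprMn; congr (_ * _).
by rewrite -mulr_natr natz exprnP exprz_exp.
Qed.

Lemma mcoeff_grad (C : fieldType) (P : multiproj) (S : coord P -> int) d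
    (p : {mpoly C[#|coord P|]}) m :
  mcoeff m (grad_component (P := P) S d p) = if wt S m == d then p@_m else 0.
Proof.
rewrite /grad_component raddf_sum /= big_mkcond.
have [mp|mp] := boolP (m \in msupp p); last first.
  rewrite memN_msupp_eq0 // if_same big_seq big1 // => m' m'p.
  case: ifP => // _; rewrite mcoeffZ mcoeffX; case: eqP => [e|]; last by rewrite mulr0.
  by rewrite -e m'p in mp.
rewrite (bigD1_seq m) ?msupp_uniq //= [X in _ + X]big1 ?addr0.
  by rewrite mcoeffZ mcoeffX eqxx mulr1.
move=> m' /negbTE ne; case: ifP => // _.
by rewrite mcoeffZ mcoeffX ne mulr0.
Qed.

(** * Initial parts of Pluecker relations vanish on the torus *)

Section InitialInToric.
Variables (C : numFieldType) (n : nat).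
Hypothesis n_ge2 : (2 <= n)%N.
Local Notation V := (plucker_index n).

(** The minors involve fewer than [n] columns, so the last column can absorb the inverse of the
    determinant without changing them. This applies to [curve], whose determinant is nonzero but
    arbitrary. *)
Lemma plucker_ideal_vanish (p : coord_ring C (plucker_space n)) (g : 'M[C]_n) :
  plucker_ideal C n p -> \det g != 0 -> evalp p (plucker_minor g) = 0.
Proof.
move=> pI g0.
have n0 : (n.-1 < n)%N by case: n n_ge2.
pose d : 'rV[C]_n := \row_j (if j == Ordinal n0 then (\det g)^-1 else 1).
pose g' := g *m diag_mx d.
have det_g' : \det g' = 1.
  rewrite det_mulmx det_diag (bigD1 (Ordinal n0)) //= mxE eqxx big1 ?mulr1 ?divff //.
  by move=> j /negbTE h; rewrite mxE h.
have -> : plucker_minor g = plucker_minor g'.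
  apply: funext => v; congr (\det _); apply/matrixP => r c; rewrite !mxE.
  rewrite (bigD1 (widen_ord (plucker_size_subproof v) c)) //= big1 => [|j].
    rewrite !mxE eqxx mulr1n (_ : _ == _ = false) ?mulr1 ?addr0 //.
    apply/negbTE/eqP => /(congr1 val) /= h.
    have := valP v => /= /andP[_]; have := ltn_ord c; rewrite h.
    by move=> h1 h2; have := leq_ltn_trans h1 h2; rewrite prednK ?ltnn // (ltn_trans _ n_ge2).
  by rewrite !mxE eq_sym => /negbTE ->; rewrite mulr0n mulr0.
by apply: evalp_ideal_gen pI => q [_]; apply; exists g'.
Qed.

Variable A : theta int n.
Hypothesis A_a : forall i : nat, (1 <= i <= n - 2)%N ->
  entry A i i.+1 + entry A i.+1 i.+2 < entry A i i.+2.
Hypothesis A_b : forall i j : nat, (1 <= i)%N -> (i < j - 1)%N ->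
  (j - 1 <= n - 2)%N ->
  entry A i j + entry A i.+1 j.+1 < entry A i j.+1 + entry A i.+1 j.

Local Notation S := (sigma A).
Local Notation toric := (torus_vanishing (P := plucker_space n) (@diag_exp n)).

(** Along the curve [p] is [e ^ d] times a polynomial in [e], which vanishes for all [e != 0], hence
    at 0; there its value is that of the initial part at the torus point. *)
Lemma initial_part_toric (p q : coord_ring C (plucker_space n)) :
  plucker_ideal C n p -> is_initial_part S p q -> toric q.
Proof.
move=> pI [d [qE q0 low]] t t0.
have ge_d m : m \in msupp (p : {mpoly C[#|V|]}) -> d <= wt S m.
  move=> mp; rewrite leNgt; apply/negP => /low/(congr1 (mcoeff m)).
  by rewrite (mcoeff_grad S) eqxx mcoeff0 => /eqP; rewrite mcoeff_eq0 mp.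
pose pol : {poly C} := \sum_(m <- msupp (p : {mpoly C[#|V|]}))
  (p : {mpoly C[#|V|]})@_m *: ('X^(absz (wt S m - d)%R) * monv (minor_poly A t) m).
have pol0 : pol = 0.
  apply: poly_vanish => e e0; apply: (mulfI (expfz_neq0 d e0)).
  have dc : \det (curve A t e) != 0.
    by rewrite det_curve; apply/prodf_neq0 => l _; exact: t0.
  rewrite mulr0 -[RHS](plucker_ideal_vanish pI dc) evalpE /pol horner_sum mulr_sumr.
  rewrite big_seq [RHS]big_seq; apply: eq_bigr => m mp.
  have -> : plucker_minor (curve A t e) = fun v => e ^ S v * (minor_poly A t v).[e].
    by apply: funext => v; exact: plucker_minor_curve.
  rewrite monv_expz // hornerZ hornerM hornerXn horner_monv mulrCA; congr (_ * _).
  rewrite mulrA exprnP -expfzDr //; congr (_ ^ _ * _).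
  by have := ge_d m mp; lia.
have := congr1 (fun r : {poly C} => r.[0]) pol0; rewrite horner0 => <-.
rewrite qE /pol horner_sum /grad_component /evalp raddf_sum /= big_mkcond.
rewrite big_seq [RHS]big_seq; apply: eq_bigr => m mp.
rewrite hornerZ hornerM hornerXn horner_monv.
have -> : (fun v => (minor_poly A t v).[0]) = fun v => charv t (diag_exp v).
  by apply: funext => v; exact: minor_poly0.
case: eqP => [h|ne].
  rewrite mevalZ (_ : wt S m = d) // subrr expr0 mul1r; congr (_ * _).
  exact: (@evalpX C (plucker_space n)).
rewrite expr0n (_ : _ == _ = false) ?mul0r ?mulr0 //.
by apply/negbTE; rewrite absz_eq0 subr_eq0; apply/eqP.
Qed.

Lemma degenerate_toric p : degenerate_flag_ideal C n S p -> toric p.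
Proof.
move=> hp t t0; apply: evalp_ideal_gen hp => q [r rI qr].
exact: initial_part_toric rI qr t t0.
Qed.

End InitialInToric.

(** * Straightening *)

Section Garnir.
Variables (C : numFieldType) (n : nat).
Implicit Types g : 'M[C]_n.

(** Rows come in any order and may repeat, as exchanging entries between two columns leaves them
    neither increasing nor distinct. *)
Definition seq_minor g k (kn : (k <= n)%N) (f : 'I_k -> 'I_n) : C :=
  \det (\matrix_(r < k, c < k) g (f r) (widen_ord kn c)).

Lemma seq_minor_alternate g k (kn : (k <= n)%N) (f : 'I_k -> 'I_n) :
  ~ injective f -> seq_minor g kn f = 0.
Proof.
move=> ninj; have /injectivePn [r [r' ne e]] : ~~ injectiveb f.
  by apply/negP => /injectiveP.
by apply: (determinant_alternate ne) => c; rewrite !mxE e.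
Qed.

Lemma seq_minor_plucker k (kn : (k <= n)%N) (f : 'I_k -> 'I_n)
    (v : plucker_index n) :
  injective f -> (forall r, f r \in val v) -> #|val v| = k ->
  exists b : bool, forall g, seq_minor g kn f = (-1) ^+ b * plucker_minor g v.
Proof.
move=> finj fv ek; subst k.
have s_inj : injective (fun r => enum_rank_in (fv r) (f r)).
  move=> r r' /(congr1 enum_val); rewrite !enum_rankK_in //; exact: finj.
exists (perm s_inj : bool) => g.
rewrite /plucker_minor -det_perm -det_mulmx -row_permE; congr (\det _).
apply/matrixP => r c; rewrite !mxE permE enum_rankK_in //.
by congr (g _ _); apply: val_inj.
Qed.

Variables (p q : nat) (rho : 'I_(p + q) -> 'I_n) (S : {set 'I_(p + q)}).

Implicit Types s : {perm 'I_(p + q)}.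

Definition left_pos (x : 'I_(p + q)) : bool := (x < p)%N.

Lemma left_lshift r : left_pos (lshift q r).
Proof. by rewrite /left_pos /= ltn_ord. Qed.

Lemma left_rshift r : left_pos (rshift p r) = false.
Proof. by rewrite /left_pos /= ltnNge leq_addr. Qed.

Definition side_preserving s : bool := [forall x, left_pos (s x) == left_pos x].

Lemma side_preservingP s :
  reflect (forall x, left_pos x -> left_pos (s x)) (side_preserving s).
Proof.
apply: (iffP forallP) => [h x lx|h x]; first by rewrite (eqP (h x)).
pose L := [set x | left_pos x].
have sL : s @: L = L.
  apply/eqP; rewrite eqEcard card_imset ?leqnn ?andbT; last exact: perm_inj.
  by apply/subsetP => _ /imsetP[y + ->]; rewrite !inE; exact: h.
apply/eqP; apply/idP/idP; last exact: h.
move=> sx; have : s x \in L by rewrite inE.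
by rewrite -sL => /imsetP[y]; rewrite inE => ly /perm_inj ->.
Qed.

Section Decrease.
Variable j : nat.
Hypothesis S_def : forall x, (x \in S) = (left_pos x != (rho x < j)%N).

Lemma big_left (F : 'I_(p + q) -> int) :
  \sum_(x | left_pos x) F x = \sum_(r < p) F (lshift q r).
Proof.
rewrite big_mkcond big_split_ord /= [X in _ + X]big1 => [|r _].
  by rewrite addr0; apply: eq_bigr => r _; rewrite left_lshift.
by rewrite left_rshift.
Qed.

(* The exchanged elements of the left block are all [>= j] and those of the
   right block are all [< j]. *)
Lemma garnir_decrease s : perm_on S s -> ~~ side_preserving s ->
  \sum_(r < p) (rho (s (lshift q r)))%:Z < \sum_(r < p) (rho (lshift q r))%:Z.
Proof.
move=> Ss nsp.
have [x lx lsx] : exists2 x, left_pos x & ~~ left_pos (s x).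
  apply/exists_inP; apply: contraNT nsp; rewrite negb_exists_in => /forall_inP h.
  by apply/side_preservingP => x /h; rewrite negbK.
pose h y : int := (rho y)%:Z - j%:Z.
have nS y : y \notin S -> (s^-1)%g y = y.
  move=> yS; apply: (@perm_inj _ s); rewrite permKV; apply/esym.
  by apply: contraNeq yS => ne; apply: (subsetP Ss); rewrite inE.
have term y : 0 <= h y *+ left_pos y - h y *+ left_pos ((s^-1)%g y).
  have [yS|/nS ->] := boolP (y \in S); last by rewrite subrr.
  by move: yS; rewrite S_def /h; case: (left_pos y) => /= yj;
    case: (left_pos _) => /=; rewrite ?mulr1n ?mulr0n; lia.
rewrite -!(big_left (fun x => (rho (_ x))%:Z)) -!(big_left (fun x => (rho x)%:Z)).
suff : \sum_(x | left_pos x) h (s x) < \sum_(x | left_pos x) h x.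
  by rewrite /h !sumrB ltrD2r.
rewrite -subr_gt0 [X in _ - X]big_mkcond [X in X - _]big_mkcond.
rewrite [X in _ - X](reindex_inj (@perm_inj _ (s^-1)%g)) -sumrB.
under eq_bigr => y _ do rewrite permKV -!mulrb.
rewrite (bigD1 (s x)) //=; apply: ltr_wpDr; first by apply: sumr_ge0 => y _; exact: term.
rewrite permK lx (negbTE lsx) mulr0n mulr1n sub0r oppr_gt0.
have : s x \in S.
  by apply: contraNT lsx => /nS; rewrite permK => <-.
by rewrite S_def (negbTE lsx) /h; case: ltnP => //; lia.
Qed.

Lemma sum_rho_perm s : \sum_x (rho (s x))%:Z = \sum_x (rho x)%:Z.
Proof. by rewrite [RHS](reindex_inj (@perm_inj _ s)). Qed.

End Decrease.

Variables (pn : (p <= n)%N) (qn : (q <= n)%N) (qp : (q <= p)%N).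

Definition pos_col (x : 'I_(p + q)) : 'I_n :=
  match split x with
  | inl c => widen_ord pn c
  | inr c => widen_ord qn c
  end.

(** It makes a product of two minors a single determinant. The permutation moves the row labels but
    not the block pattern, so it amounts to a permutation of the rows when it preserves the
    sides. *)
Definition block_matrix g s : 'M[C]_(p + q) :=
  \matrix_(x, y) ((left_pos x == left_pos y)%:R * g (rho (s x)) (pos_col y)).

Definition two_minors g s : C :=
  seq_minor g pn (fun r => rho (s (lshift q r))) *
  seq_minor g qn (fun r => rho (s (rshift p r))).

Lemma det_block_matrix g s : \det (block_matrix g s) = two_minors g s.
Proof.
rewrite /two_minors /seq_minor -(det_ublock _ 0); congr (\det _).
apply/matrixP => x y; rewrite mxE -[x]splitK -[y]splitK.
case: (split x) => r; case: (split y) => c;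
  rewrite /= ?(block_mxEul, block_mxEur, block_mxEdl, block_mxEdr) ?mxE
    ?left_lshift ?left_rshift /= ?mul0r // mul1r /pos_col;
  by [rewrite (unsplitK (inl c)) | rewrite (unsplitK (inr c))].
Qed.

Lemma pos_col_lt x : (pos_col x < p)%N.
Proof. by rewrite /pos_col; case: split => c //=; apply: leq_trans qp. Qed.

(* Two positions of [S] meet the same column, so that swapping them matches the
   terms of the sum in pairs of opposite sign. *)
Lemma garnir g : (p < #|S|)%N ->
  \sum_(s | perm_on S s) (-1) ^+ s * two_minors g s = 0.
Proof.
move=> cardS.
under eq_bigr do rewrite -det_block_matrix /determinant mulr_sumr.
rewrite exchange_big big1 // => u _.
pose col z := Ordinal (pos_col_lt (u z)).
have [x [y [xS yS xy cxy]]] : exists x y, [/\ x \in S, y \in S, x != y & col x = col y].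
  have /dinjectivePn [x xS [y]] : ~~ dinjectiveb col (mem S).
    apply: contraTN cardS => /dinjectiveP /card_in_image h.
    by rewrite -leqNgt -h -[leqRHS]card_ord max_card.
  by rewrite inE /= => /andP[ne yS] e; exists x, y; rewrite eq_sym.
set t := tperm x y.
pose F s := \prod_z g (rho (s z)) (pos_col (u z)).
have tS : perm_on S t.
  by apply/subsetP => z; rewrite inE /t; case: tpermP => [->|->|] //; rewrite eqxx.
have Ft s : F (t * s)%g = F s.
  rewrite /F (reindex_inj (@perm_inj _ t)); apply: eq_bigr => z _.
  rewrite permM tpermK; congr (g _ _); apply: val_inj.
  rewrite /t; case: tpermP => // ->; by have := congr1 val cxy.
pose T := \sum_(s | perm_on S s) (-1) ^+ s * F s : C.
have T0 : T = 0.
  have e : T = - T.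
    rewrite {1}/T (reindex_inj (mulgI t)) -sumrN.
    apply: eq_big => [s|s _].
      apply/idP/idP => h; last exact: perm_onM.
      by rewrite -[s](mulKg t) tpermV; apply: perm_onM.
    by rewrite Ft odd_mul_tperm xy signr_addb expr1 mulN1r mulNr.
  have /eqP : T *+ 2 = 0 by rewrite mulr2n {2}e subrr.
  by rewrite mulrn_eq0 => /eqP.
transitivity ((-1) ^+ u * (\prod_z ((left_pos z == left_pos (u z))%:R : C)) * T).
  rewrite /T mulr_sumr; apply: eq_bigr => s _.
  have -> : \prod_z block_matrix g s z (u z) =
      \prod_z ((left_pos z == left_pos (u z))%:R : C) * F s.
    by rewrite -big_split; apply: eq_bigr => z _; rewrite mxE.
  by rewrite [RHS]mulrCA !mulrA.
by rewrite T0 mulr0.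
Qed.

(** Hence the original product occurs in the Garnir sum with a positive multiplicity and can be
    solved for. *)
Lemma two_minors_side_preserving g s : side_preserving s ->
  (-1) ^+ s * two_minors g s = two_minors g 1.
Proof.
move=> /forallP sp; rewrite -!det_block_matrix.
have -> : block_matrix g s = row_perm s (block_matrix g 1).
  by apply/matrixP => x y; rewrite !mxE perm1 (eqP (sp x)).
by rewrite row_permE det_mulmx det_perm mulrA -signr_addb addbb mul1r.
Qed.

End Garnir.

Lemma mulrn_int (x : int) k : x *+ k = x * k%:Z.
Proof. by rewrite -mulr_natr natz. Qed.

Section Straightening.
Variables (C : numFieldType) (n : nat).
Local Notation V := (plucker_index n).
Local Notation deg := (fdeg (@fac (plucker_space n))).
Implicit Types (v u : V) (m : 'X_{1..#|V|}) (g : 'M[C]_n).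

(* Exchanging entries of a set for smaller ones increases its key, and a larger
   set has a larger key. *)
Definition key v : int := \sum_(s in val v) ((n * n + n).+1%:Z - (s : nat)%:Z).

Lemma keyE v : key v = (n * n + n).+1%:Z *+ #|val v| - \sum_(s in val v) (s : nat)%:Z.
Proof. by rewrite /key sumrB sumr_const. Qed.

Lemma key_bound v : 0 <= key v <= ((n * n + n).+1 * n)%N%:Z.
Proof.
apply/andP; split; first by apply: sumr_ge0 => s _; have := ltn_ord s; nia.
have h : #|val v|%:Z <= n%:Z by case/andP: (plucker_card v) => _ /ltnW.
apply: (@le_trans _ _ ((n * n + n).+1%:Z *+ #|val v|)); last first.
  rewrite mulrn_int; nia.
by rewrite keyE lerBlDr lerDl sumr_ge0.
Qed.

(** The elements of [u] sum to at most [n * n], less than the constant contributed by one more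
    element; this is where the size of the constant comes from. *)
Lemma key_card v u : (#|val v| < #|val u|)%N -> key v < key u.
Proof.
move=> h; have hv : key v <= (n * n + n).+1%:Z *+ #|val v|.
  by rewrite keyE lerBlDr lerDl sumr_ge0.
have hu : (n * n + n).+1%:Z *+ #|val u| - n%:Z * n%:Z <= key u.
  rewrite keyE lerD2l lerN2.
  apply: (@le_trans _ _ (\sum_(s in val u) n%:Z)).
    by apply: ler_sum => s _; have := ltn_ord s; lia.
  rewrite sumr_const mulrn_int.
  have : #|val u|%:Z <= n%:Z by case/andP: (plucker_card u) => _ /ltnW.
  nia.
apply: le_lt_trans hv (lt_le_trans _ hu).
rewrite !mulrn_int; nia.
Qed.

Lemma plucker_of_seq k (f : 'I_k -> 'I_n) : injective f -> (0 < k < n)%N ->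
  exists v : V, [/\ forall r, f r \in val v, #|val v| = k &
    forall F : 'I_n -> int, \sum_(s in val v) F s = \sum_r F (f r)].
Proof.
move=> finj hk; have hc : #|f @: setT| = k.
  by rewrite card_imset // cardsT card_ord.
have hv : (0 < #|f @: setT| < n)%N by rewrite hc.
exists (Sub (f @: setT) hv); rewrite SubK; split=> // [r|F].
  by rewrite imset_f.
rewrite big_imset /=; last by move=> r r' _ _; exact: finj.
by apply: eq_bigl => r; rewrite inE.
Qed.

Lemma sum_enum_val_lt (B : {set 'I_n}) j :
  (\sum_(r < #|B|) (enum_val r < j) = #|[set s in B | (s < j)%N]|)%N.
Proof.
rewrite -sum1dep_card -(big_enum_val (fun s : 'I_n => (s < j)%N : nat)) /=.
rewrite big_mkcond [RHS]big_mkcond; apply: eq_bigr => s _.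
by case: (s \in B); case: (s < j)%N.
Qed.

Lemma straighten_pair v u j : (#|val u| <= #|val v|)%N -> (cnt v j < cnt u j)%N ->
  exists (T : finType) (P : pred T) (c : T -> C) (vu : T -> V * V),
    (forall i, P i -> [/\ #|val (vu i).1| = #|val v|, #|val (vu i).2| = #|val u|,
        key v < key (vu i).1 & key (vu i).1 + key (vu i).2 = key v + key u]) /\
    forall g, plucker_minor g v * plucker_minor g u =
      \sum_(i | P i) c i * (plucker_minor g (vu i).1 * plucker_minor g (vu i).2).
Proof.
move=> qp vuj; set p := #|val v|; set q := #|val u|.
pose pn := plucker_size_subproof v; pose qn := plucker_size_subproof u.
pose rho (x : 'I_(p + q)) : 'I_n :=
  match split x with inl r => enum_val r | inr r => enum_val r end.
have rhoL r : rho (lshift q r) = enum_val r by rewrite /rho (unsplitK (inl r)).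
have rhoR r : rho (rshift p r) = enum_val r by rewrite /rho (unsplitK (inr r)).
(* The exchanged positions carry the entries [>= j] of [v] and the entries [< j] of [u]: there are
   [p - cnt v j + cnt u j > p] of them. *)
pose S := [set x | left_pos x != (rho x < j)%N].
have SE x : (x \in S) = (left_pos x != (rho x < j)%N) by rewrite inE.
have sv0 : \sum_(s in val v) (s : nat)%:Z = \sum_(r < p) (rho (lshift q r) : nat)%:Z.
  by rewrite big_enum_val; apply: eq_bigr => r _; rewrite rhoL.
have su0 : \sum_(s in val u) (s : nat)%:Z = \sum_(r < q) (rho (rshift p r) : nat)%:Z.
  by rewrite big_enum_val; apply: eq_bigr => r _; rewrite rhoR.
have cardS : (p < #|S|)%N.
  rewrite -sum1dep_card big_mkcond big_split_ord /=.
  under eq_bigr => r _ do rewrite left_lshift rhoL.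
  under [X in (_ + X)%N]eq_bigr => r _ do rewrite left_rshift rhoR.
  have hv : (\sum_(r < p) (if true != (enum_val r < j)%N then 1 else 0) + cnt v j)%N = p.
    rewrite /cnt -sum_enum_val_lt -big_split /= -[RHS]card_ord -sum1_card.
    by apply: eq_bigr => r _; case: (_ < j)%N.
  have hu : (\sum_(r < q) (if false != (enum_val r < j)%N then 1 else 0))%N = cnt u j.
    by rewrite /cnt -sum_enum_val_lt; apply: eq_bigr => r _; case: (_ < j)%N.
  rewrite hu -[X in (X < _)%N]hv ltn_add2l.
  exact: vuj.
pose fl (s : {perm 'I_(p + q)}) r := rho (s (lshift q r)).
pose fr (s : {perm 'I_(p + q)}) r := rho (s (rshift p r)).
(* A filling with a repeated row gives a zero minor, so the remaining terms all come from pairs of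
   sets. *)
pose P s := [&& perm_on S s, ~~ side_preserving s,
  injectiveb (fl s) & injectiveb (fr s)].
have /choice [w wP] (s : {perm 'I_(p + q)}) : exists w : V * V * bool, P s ->
    [/\ #|val w.1.1| = p, #|val w.1.2| = q, key v < key w.1.1,
        key w.1.1 + key w.1.2 = key v + key u &
        forall g, two_minors rho pn qn g s =
          (-1) ^+ w.2 * (plucker_minor g w.1.1 * plucker_minor g w.1.2)].
  have [Ps|] := boolP (P s); last by exists (v, u, false).
  case/and4P: Ps => Ss nsp /injectiveP il /injectiveP ir.
  have [v' [fv cv sv]] := plucker_of_seq il (plucker_card v).
  have [u' [fu cu su]] := plucker_of_seq ir (plucker_card u).
  have [b bE] := seq_minor_plucker C pn il fv cv.
  have [b' b'E] := seq_minor_plucker C qn ir fu cu.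
  exists (v', u', b (+) b') => _; split=> //=.
  - rewrite !keyE cv ltrD2l ltrN2 sv sv0.
    have := garnir_decrease SE Ss nsp.
    exact.
  - rewrite !keyE cv cu sv su sv0 su0.
    have := sum_rho_perm rho s; rewrite !big_split_ord /= => e.
    rewrite addrACA [RHS]addrACA; congr (_ + _); rewrite -!opprD; congr (- _).
    exact: e.
  by move=> g; rewrite /two_minors bE b'E signr_addb mulrACA.
(* The multiplicity of the original product; it is invertible in characteristic 0. *)
pose kappa := #|[set s : {perm 'I_(p + q)} | perm_on S s && side_preserving s]|.
have kappa0 : (0 < kappa)%N.
  apply/card_gt0P; exists 1%g; rewrite inE perm_on1 /=.
  by apply/side_preservingP => x; rewrite perm1.
exists {perm 'I_(p + q)}, P.
exists (fun s : {perm 'I_(p + q)} => - (kappa%:R)^-1 * ((-1) ^+ s * (-1) ^+ (w s).2)).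
exists (fun s => (w s).1); split=> [s /wP[]|g]; first by [].
have k0 : (kappa%:R : C) != 0 by rewrite pnatr_eq0 -lt0n.
apply: (mulfI k0).
have := garnir rho pn qn qp g cardS.
rewrite (bigID (@side_preserving p q)) /=.
have -> : \sum_(s : {perm 'I_(p + q)} | perm_on S s && side_preserving s) (-1) ^+ s * two_minors rho pn qn g s =
    kappa%:R * (plucker_minor g v * plucker_minor g u).
  rewrite (eq_bigr (fun=> two_minors rho pn qn g 1)); last first.
    by move=> s /andP[_]; exact: two_minors_side_preserving.
  rewrite sumr_const /kappa cardsE -[LHS]mulr_natl /two_minors; congr (_ * (_ * _)).
    by congr (\det _); apply/matrixP => r c; rewrite !mxE perm1 rhoL.
  by congr (\det _); apply/matrixP => r c; rewrite !mxE perm1 rhoR.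
move/eqP; rewrite addr_eq0 => /eqP ->; rewrite mulr_sumr -sumrN.
rewrite (bigID (fun s => injectiveb (fl s) && injectiveb (fr s))) /= addrC.
rewrite big1 ?add0r => [|s /andP[_ h]].
  apply: eq_big => [s|s /andP[/andP[Ss nsp] /andP[il ir]]].
    by rewrite /P -!andbA.
  have [|_ _ _ _ ->] := wP s; first by rewrite /P Ss nsp il ir.
  by rewrite -mulrA mulNr mulrN mulVKf // !mulrA.
rewrite /two_minors; move: h; rewrite negb_and => /orP[] /injectiveP h.
  by rewrite (seq_minor_alternate g pn h) mul0r mulr0 oppr0.
by rewrite [X in _ * (_ * X)](seq_minor_alternate g qn h) !mulr0 oppr0.
Qed.

End Straightening.

Section StraighteningTheorem.
Variables (C : numFieldType) (n : nat).
Local Notation V := (plucker_index n).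
Local Notation deg := (fdeg (@fac (plucker_space n))).

Lemma plucker_fac (v u : V) : #|val v| = #|val u| ->
  fac (m := plucker_space n) v = fac (m := plucker_space n) u.
Proof. by move=> e; apply: val_inj; rewrite /= e. Qed.

Lemma pot_bound (m : 'X_{1..#|V|}) :
  wt (fun v => key v ^+ 2) m <=
  ((n * n + n).+1 * n)%N%:Z ^+ 2 * (\sum_v mult m v)%N%:Z.
Proof.
rewrite (big_morph Posz PoszD (erefl : Posz 0 = 0)) mulr_sumr.
apply: ler_sum => v _; rewrite mulrn_int ler_wpM2r //.
have /andP[k0 kB] := key_bound v; by rewrite ler_sqr // nnegrE (le_trans k0).
Qed.

(** It terminates because an exchange turns keys [x >= y] into [x + d] and [y - d] with [d > 0]: the
    sum of squares increases, while it is bounded in terms of the degree. *)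
Lemma straighten (m : 'X_{1..#|V|}) :
  exists r : {mpoly C[#|V|]},
    (forall m', m' \in msupp r -> standard m' /\ forall d, deg m' d = deg m d) /\
    forall g : 'M[C]_n, monv (plucker_minor g) m =
      evalp (P := plucker_space n) r (plucker_minor g).
Proof.
pose B2 := ((n * n + n).+1 * n)%N%:Z ^+ 2.
pose pot (m : 'X_{1..#|V|}) : int := wt (fun v => key v ^+ 2) m.
have [k] : exists k : nat, B2 * (\sum_v mult m v)%N%:Z - pot m < k%:Z.
  exists (absz (B2 * (\sum_v mult m v)%N%:Z - pot m)%R).+1.
  by case: (B2 * _ - _) => a; lia.
elim: k m => [|k IH] m hk.
  by have := pot_bound m; rewrite -subr_ge0 leNgt hk.
have [st|nst] := pselect (standard m).
  exists 'X_[m]; split=> [m'|g]; last by rewrite evalpX.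
  by rewrite msuppX inE => /eqP ->.
(* Ordering the incomparable pair by key serves twice: the first column is at least as long, as the
   Garnir relation requires, and the exchange raises the larger key. *)
have [v [w [mv mw nvw nwv kwv]]] : exists v w : V,
    [/\ (0 < mult m v)%N, (0 < mult m w)%N, ~~ cnt_ge v w, ~~ cnt_ge w v &
        key w <= key v].
  apply: contrapT => H; apply: nst => v w mv mw.
  apply: contraT; rewrite negb_or => /andP[nvw nwv]; exfalso; apply: H.
  by case/orP: (le_total (key w) (key v)) => h; [exists v, w | exists w, v].
have vw : v != w.
  by apply: contraNneq nvw => ->; apply/cnt_geP.
have cw : (#|val w| <= #|val v|)%N.
  by rewrite leqNgt; apply/negP => /key_card; rewrite ltNge kwv.
have [j vj] : exists j, (cnt v j < cnt w j)%N.
  move: nvw; rewrite negb_forall => /existsP[j]; rewrite -ltnNge; by exists j.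
have [T [P [c [vu [hP hE]]]]] := straighten_pair C cw vj.
pose m0 := (m - mvar v - mvar w)%MM.
have mE : m = (m0 + mvar w + mvar v)%MM.
  rewrite /m0 mvar_le ?mvar_le // multB mult_mvar (negbTE vw) subn0 //.
pose m_ i := (m0 + mvar (vu i).2 + mvar (vu i).1)%MM.
have deg_m i : P i -> forall d, deg (m_ i) d = deg m d.
  case/hP => [e1 e2 _ _] d.
  by rewrite mE !fdegD !fdeg_mvar (plucker_fac e1) (plucker_fac e2).
have /choice [r rP] i : exists r : {mpoly C[#|V|]}, P i ->
    (forall m', m' \in msupp r -> standard m' /\ forall d, deg m' d = deg m d) /\
    forall g : 'M[C]_n, monv (plucker_minor g) (m_ i) =
      evalp (P := plucker_space n) r (plucker_minor g).
  have [Pi|_] := boolP (P i); last by exists 0.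
  have [|r [r1 r2]] := IH (m_ i).
    have degE (m1 : 'X_{1..#|V|}) : (\sum_v mult m1 v)%N = (\sum_d deg m1 d)%N.
      exact: (partition_big (@fac (plucker_space n)) predT).
    rewrite degE (eq_bigr _ (fun d _ => deg_m i Pi d)) -degE.
    apply: (lt_le_trans (y := B2 * (\sum_v mult m v)%N%:Z - pot m)); last by lia.
    rewrite ltrD2l ltrN2 /pot mE !wtD !wt_mvar -!addrA ltrD2l.
    have [_ _ lt1 e1] := hP _ Pi.
    have -> : key (vu i).2 = key w - (key (vu i).1 - key v) by lia.
    nia.
  exists r => _; split=> // m' /r1 [st1 d1]; split=> // d.
  by rewrite d1 deg_m.
exists (\sum_(i | P i) c i *: r i); split=> [m'|g].
  move/msupp_sum_le/flattenP => [s0 /mapP[i + ->]].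
  rewrite mem_filter => /andP[Pi _] /msuppZ_le h.
  by have [r1 _] := rP _ Pi; exact: r1.
rewrite mE !monvD !monv_mvar -mulrA [X in _ * X]mulrC hE mulr_sumr.
rewrite /evalp raddf_sum /=; apply: eq_bigr => i Pi.
have [_ r2] := rP _ Pi; rewrite mevalZ.
transitivity (c i * monv (plucker_minor g) (m_ i)); last by rewrite r2.
rewrite !monvD !monv_mvar; ring.
Qed.

End StraighteningTheorem.

(** * The initial ideal *)

Lemma seq_argmin (T : eqType) (f : T -> int) (s : seq T) : s != [::] ->
  exists2 x, x \in s & forall y, y \in s -> f x <= f y.
Proof.
elim: s => // x [|y s] IH _.
  by exists x; rewrite ?inE // => y; rewrite inE => /eqP ->.
have [//|z zs zmin] := IH; have [h|h] := leP (f x) (f z).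
  exists x; rewrite ?mem_head // => u; rewrite inE => /predU1P[-> //|/zmin].
  exact: le_trans.
exists z; first by rewrite inE zs orbT.
move=> u; rewrite inE => /predU1P[->|/zmin //]; exact: ltW.
Qed.

Section ToricInInitial.
Variables (C : numFieldType) (n : nat).
Hypothesis n_ge2 : (2 <= n)%N.
Local Notation V := (plucker_index n).
Local Notation deg := (fdeg (@fac (plucker_space n))).
Implicit Types m : 'X_{1..#|V|}.

Variable A : theta int n.
Hypothesis A_a : forall i : nat, (1 <= i <= n - 2)%N ->
  entry A i i.+1 + entry A i.+1 i.+2 < entry A i i.+2.
Hypothesis A_b : forall i j : nat, (1 <= i)%N -> (i < j - 1)%N ->
  (j - 1 <= n - 2)%N ->
  entry A i j + entry A i.+1 j.+1 < entry A i j.+1 + entry A i.+1 j.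

Local Notation S := (sigma A).
Local Notation toric := (torus_vanishing (P := plucker_space n) (@diag_exp n)).
Local Notation degenerate := (degenerate_flag_ideal C n S).

Lemma standard_inj m m' : standard m -> standard m' ->
  wt (@diag_exp n) m = wt (@diag_exp n) m' -> m = m'.
Proof. by move=> sm sm' /diag_exp_row; exact: standard_unique. Qed.

Lemma initial_part_exists (q : {mpoly C[#|V|]}) : q != 0 ->
  exists2 d, is_initial_part (P := plucker_space n) S q (grad_component (P := plucker_space n) S d q) &
    exists2 m, m \in msupp q & wt S m = d.
Proof.
move=> q0; have [m0 m0q m0min] : exists2 m, m \in msupp q &
    forall m', m' \in msupp q -> wt S m <= wt S m'.
  by apply: seq_argmin; rewrite msupp_eq0.
exists (wt S m0); last by exists m0.
exists (wt S m0); split=> // [/(congr1 (mcoeff m0))|e lt_e].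
  by rewrite (mcoeff_grad S) eqxx mcoeff0 => /eqP; rewrite mcoeff_eq0 m0q.
apply/mpolyP => m; rewrite (mcoeff_grad S) mcoeff0; case: eqP => // me.
by apply: memN_msupp_eq0; apply: contraTN lt_e => /m0min; rewrite me leNgt.
Qed.

Lemma torus_class_partner (q : {mpoly C[#|V|]}) m : toric q -> m \in msupp q ->
  exists m', [/\ m' \in msupp q, m' != m & wt (@diag_exp n) m' = wt (@diag_exp n) m].
Proof.
move=> tq mq; apply: contrapT => H.
have := torus_class_sum (wt (@diag_exp n) m) tq.
rewrite big_mkcond (bigD1_seq m) ?msupp_uniq //= eqxx big_seq_cond big1 ?addr0.
  by move/eqP; rewrite mcoeff_eq0 mq.
move=> m' /andP[m'q ne]; case: eqP => // e.
by case: H; exists m'.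
Qed.

Lemma degenerate_standard m : exists m', [/\ standard m',
  wt (@diag_exp n) m' = wt (@diag_exp n) m & degenerate ('X_[m] - 'X_[m'])].
Proof.
have [sm|nsm] := pselect (standard m).
  by exists m; split=> //; rewrite subrr; exact: ideal_gen0.
have [r [rs rE]] := straighten C m.
pose q : {mpoly C[#|V|]} := 'X_[m] - r.
have mr : m \notin msupp r by apply/negP => /rs[].
have qm : q@_m = 1.
  by rewrite mcoeffB mcoeffX eqxx (memN_msupp_eq0 mr) subr0.
have qI : plucker_ideal C n q.
  apply: ideal_gen_in; split.
    exists (deg m); apply: has_multidegreeB; first exact: has_multidegreeX.
    by move=> m' /rs[].
  move=> x [g [_ xg]]; rewrite (funext xg) evalpB evalpX rE.
  exact: subrr.
have q0 : q != 0 by apply: contra_eq_neq qm => ->; rewrite mcoeff0 eq_sym oner_eq0.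
have [d init_d [m1 m1q m1d]] := initial_part_exists q0.
set qd : {mpoly C[#|V|]} := grad_component (P := plucker_space n) S d q in init_d.
have tqd : toric qd := initial_part_toric n_ge2 A_a A_b qI init_d.
have sub m' : m' \in msupp qd -> m' = m \/ standard m'.
  rewrite mcoeff_msupp (mcoeff_grad S); case: ifP => [_|]; last by rewrite eqxx.
  rewrite -mcoeff_msupp => /msuppB_le; rewrite mem_cat msuppX inE.
  by case/orP => [/eqP|/rs[]]; [left | right].
(* A class contains at most one standard monomial, so a standard monomial in the support can only be
   cancelled on the torus by [m]. *)
have partner m' : m' \in msupp qd -> m' != m -> standard m' /\
    (m \in msupp qd /\ wt (@diag_exp n) m' = wt (@diag_exp n) m).
  move=> m'q ne; have [e|sm'] := sub _ m'q; first by rewrite e eqxx in ne.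
  split=> //; have [m2 [m2q ne2 e2]] := torus_class_partner tqd m'q.
  have [<-|sm2] := sub _ m2q; first by [].
  by rewrite (standard_inj sm2 sm' e2) eqxx in ne2.
have m1qd : m1 \in msupp qd.
  by rewrite mcoeff_msupp (mcoeff_grad S) m1d eqxx -mcoeff_msupp.
have mqd : m \in msupp qd.
  by have [<- //|ne] := eqVneq m1 m; have [_ []] := partner _ m1qd ne.
have [m' [m'q ne e]] := torus_class_partner tqd mqd.
have [sm' _] := partner _ m'q ne.
exists m'; split=> //.
have supp : perm_eq (msupp qd) [:: m; m'].
  apply: uniq_perm; rewrite ?msupp_uniq //= ?inE 1?eq_sym ?ne // => m2.
  rewrite !inE; apply/idP/orP => [m2q|[/eqP ->|/eqP ->] //].
  have [|ne2] := eqVneq m2 m; [by left | right].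
  have [sm2 [_ e2]] := partner _ m2q ne2.
  by apply/eqP/standard_inj; rewrite // e2.
have qdm : qd@_m = 1.
  move: mqd; rewrite mcoeff_msupp (mcoeff_grad S) qm.
  by case: ifP => //; rewrite eqxx.
have qdm' : qd@_m' = -1.
  have := torus_class_sum (wt (@diag_exp n) m) tqd.
  rewrite (perm_big _ supp) !big_cons big_nil /= eqxx e eqxx addr0 qdm.

  by rewrite addrC => /(canRL (addrK _)); rewrite sub0r.
have -> : 'X_[m] - 'X_[m'] = qd.
  rewrite [RHS]mpolyE (perm_big _ supp) big_cons big_seq1 qdm qdm'.
  by rewrite scale1r scaleN1r.
by apply: ideal_gen_in; exists q.
Qed.

Lemma degenerate_toricP p : degenerate p <-> toric p.
Proof.
split; first exact: degenerate_toric.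
move=> tp; apply: (torus_vanishing_ind _ _ _ tp).
- exact: ideal_gen0.
- by move=> q r; exact: ideal_genD.
- by move=> c q; exact: ideal_genZ.
move=> m m' _ _ e; have [m1 [s1 e1 d1]] := degenerate_standard m.
have [m2 [s2 e2 d2]] := degenerate_standard m'.
have m12 : m1 = m2 by apply: standard_inj; rewrite // e1 e2.
have -> : 'X_[m] - 'X_[m'] =
    ('X_[m] - 'X_[m1]) + (-1) *: ('X_[m'] - 'X_[m2]) :> {mpoly C[#|V|]}.
  by rewrite m12 scaleN1r opprB addrA subrK.
by apply: ideal_genD; last exact: ideal_genZ.
Qed.

End ToricInInitial.

(** * Lattice points and patterns *)

(** The true values form an initial segment, whose length is their number. *)
Lemma antitone_count (b : nat -> bool) j :
  (forall i, (0 < i < j)%N -> b i.+1 -> b i) ->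
  forall i, (0 < i <= j)%N -> b i = (i <= \sum_(1 <= k < j.+1) b k)%N.
Proof.
elim: j => [|j IH] h i /andP[i0]; first by rewrite leqNgt i0.
have hj : forall i, (0 < i < j)%N -> b i.+1 -> b i.
  by move=> k /andP[k0 kj]; apply: h; rewrite k0 ltnW.
have le_j : (\sum_(1 <= k < j.+1) b k <= j)%N.
  by rewrite -[leqRHS]muln1 -[X in (X * _)%N](subn1 j.+1) -sum_nat_const_nat leq_sum // => k _; exact: leq_b1.
rewrite big_nat_recr //=; case: (boolP (b j.+1)) => bj.
  have all_b k : (0 < k <= j.+1)%N -> b k.
    move=> /andP[k0 /subnK]; move: (j.+1 - k)%N => d e; elim: d k k0 e => [|d IHd] k k0 e.
      by rewrite add0n in e; rewrite e.
    apply: h; first by rewrite k0; lia.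
    by apply: IHd => //; lia.
  have eqj : (\sum_(1 <= k < j.+1) b k)%N = j.
    apply/eqP; rewrite eqn_leq le_j; case: j IH h hj le_j bj all_b => // j IH h hj le_j bj all_b.
    by rewrite -(IH hj) ?leqnn // all_b //=; lia.
  by move=> ij; rewrite eqj addn1 ij all_b // i0 ij.
rewrite addn0 leq_eqVlt => /predU1P[->|ij]; last by rewrite -(IH hj) // i0.
by rewrite (negbTE bj) ltnNge le_j.
Qed.

Section Patterns.
Variable n : nat.
Local Notation V := (plucker_index n).
Local Notation deg := (fdeg (@fac (plucker_space n))).

Lemma row_le_succ (m : 'X_{1..#|V|}) i j : row_count m i j <= row_count m i j.+1.
Proof.
apply: ler_sum => v _; rewrite lerMn2r; apply/orP; right.
by have := cnt_le_succ v j; lia.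
Qed.

Lemma row_succ_le (m : 'X_{1..#|V|}) i j : row_count m i.+1 j.+1 <= row_count m i j.
Proof.
apply: ler_sum => v _; rewrite lerMn2r; apply/orP; right.
by have := cnt_succ_le v j; lia.
Qed.

Lemma row_last (m : 'X_{1..#|V|}) : row_count m n n = 0.
Proof.
rewrite /row_count /wt big1 // => v _; rewrite cnt_large // leqNgt.
by case/andP: (plucker_card v) => _ ->; rewrite mul0rn.
Qed.

Lemma row_deg (m : 'X_{1..#|V|}) i (hi : (i < n.-1)%N) :
  row_count m i.+1 n = (deg m (Ordinal hi))%:Z + row_count m i.+2 n.
Proof. by rewrite deg_row subrK. Qed.

Lemma deg_eq_row (m m' : 'X_{1..#|V|}) : (forall d, deg m d = deg m' d) ->
  forall i, (0 < i <= n)%N -> row_count m i n = row_count m' i n.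
Proof.
move=> h i /andP[i0 /subnK]; move: (n - i)%N => d; elim: d i i0 => [|d IH] i i0 e.
  have -> : i = n by lia.
  by rewrite !row_last.
case: i i0 e => // i _ e; have hi : (i < n.-1)%N by lia.
by rewrite !(row_deg _ hi) h IH //; lia.
Qed.

Hypothesis n_gt0 : (0 < n)%N.

(** A 0-1 pattern is a single column: [r j], the number of true values at [j], grows by 0 or 1 at
    each step, and the column consists of the places where it grows. The conditions at [n] exclude
    the empty and the full set. *)
Lemma threshold (b : nat -> nat -> bool) :
  (forall i j, (0 < i <= j)%N -> (j < n)%N -> b i j -> b i j.+1) ->
  (forall i j, (0 < i <= j)%N -> (j < n)%N -> b i.+1 j.+1 -> b i j) ->
  b 1%N n -> ~~ b n n ->
  exists v : V, forall i j, (0 < i <= j)%N -> (j <= n)%N -> b i j = (i <= cnt v j)%N.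
Proof.
move=> hr hd b1 bn.
pose r j := (\sum_(1 <= k < j.+1) b k j)%N.
have rE i j : (0 < i <= j)%N -> (j <= n)%N -> b i j = (i <= r j)%N.
  move=> ij jn; apply: antitone_count ij => k /andP[k0 kj] bk.
  case: j jn kj bk => // j jn kj bk.
  by apply: hr; rewrite ?k0 //; apply: hd; rewrite ?k0.
have r_le j : (r j <= j)%N.
  rewrite -[leqRHS]muln1 -[X in (X * _)%N](subn1 j.+1) -sum_nat_const_nat.
  by apply: leq_sum => k _; exact: leq_b1.
have rS j : (j < n)%N -> (r j <= r j.+1 <= (r j).+1)%N.
  move=> jn; apply/andP; split.
    case: (posnP (r j)) => [-> //|r0]; rewrite -rE ?r0 ?(leq_trans (r_le j)) //.
    by apply: hr; rewrite ?r0 ?r_le // rE ?r0 ?r_le // ltnW.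
  case: (leqP (r j.+1) 1) => [h|h]; first exact: leq_trans h _.
  have [k ek] : exists k, r j.+1 = k.+2 by exists (r j.+1 - 2)%N; lia.
  rewrite ek ltnS -rE; [|by have := r_le j.+1; lia | exact: ltnW].
  by apply: hd; [have := r_le j.+1; lia | | rewrite rE // -ek ?leqnn ?r_le //; lia].
pose B := [set s : 'I_n | r s.+1 != r s].
have r0 : r 0%N = 0%N by rewrite /r big_geq.
have cB j : (j <= n)%N -> #|[set s in B | (s < j)%N]| = r j.
  elim: j => [|j IH] jn; first by rewrite card_below0.
  rewrite (card_belowS B (Ordinal jn)) IH ?(ltnW jn) // inE /=.
  by have := rS _ jn; case: eqP; lia.
have cBn : #|B| = r n.
  by rewrite -cB //; apply: eq_card => s; rewrite [in RHS]inE ltn_ord andbT.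
have hB : (0 < #|B| < n)%N.
  by rewrite cBn -rE ?n_gt0 // b1 /= ltnNge -rE ?n_gt0 ?leqnn.
by exists (Sub B hB) => i j ij jn; rewrite /cnt SubK cB // rE.
Qed.

Lemma pattern_decode_nat (N : nat -> nat -> nat) :
  (forall i j, (0 < i <= j)%N -> (j < n)%N -> (N i j <= N i j.+1)%N) ->
  (forall i j, (0 < i <= j)%N -> (j < n)%N -> (N i.+1 j.+1 <= N i j)%N) ->
  N n n = 0%N ->
  exists m : 'X_{1..#|V|}, forall i j, (0 < i <= j)%N -> (j <= n)%N ->
    (N i j)%:Z = row_count m i j.
Proof.
move eqk : (N 1%N n) => k; elim: k N eqk => [|k IH] N eqk hr hd hn.
  (* Every entry is at most [N 1 n], so the pattern is 0 when the induction on [N 1 n] ends. *)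
  have hN d i : (0 < i)%N -> (i + d <= n)%N -> (N i (i + d) <= N 1 n)%N.
    elim: i => // i IHi _ h; case: (posnP i) => [i0|i0]; last first.
      by apply: leq_trans (hd _ _ _ _) (IHi i0 _); lia.
    subst i.
    move: h; clear IHi; move eqx : (n - (1 + d))%N => x; elim: x d eqx => [|x IHx] d eqx h.
      by rewrite (_ : n = (1 + d)%N) //; lia.
    apply: leq_trans (hr _ _ _ _) _; [lia | lia |].
    by rewrite -addnS; apply: IHx; lia.
  exists 0%MM => i j /andP[i0 /subnKC <-] jn.
  by have := hN _ _ i0 jn; rewrite eqk leqn0 /row_count wt0 => /eqP ->.
have [|||| v vE] := threshold (b := fun i j => (0 < N i j)%N).
- by move=> i j ij jn h; exact: leq_trans h (hr _ _ ij jn).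
- by move=> i j ij jn h; exact: leq_trans h (hd _ _ ij jn).
- by rewrite eqk.
- by rewrite hn.
have [||||m mE] := IH (fun i j => (N i j).-1).
- by rewrite eqk.
- by move=> i j ij jn; have := hr _ _ ij jn; lia.
- by move=> i j ij jn; have := hd _ _ ij jn; lia.
- by rewrite hn.
exists (m + mvar v)%MM => i j ij jn.
by rewrite rowD row_mvar -mE // -vE //; case: (N i j) => //= x; lia.
Qed.

Lemma pattern_decode (N : nat -> nat -> int) :
  (forall i j, (0 < i <= j)%N -> (j < n)%N -> N i j <= N i j.+1) ->
  (forall i j, (0 < i <= j)%N -> (j < n)%N -> N i.+1 j.+1 <= N i j) ->
  (forall i, (0 < i <= n)%N -> 0 <= N i n) -> N n n = 0 ->
  exists m : 'X_{1..#|V|}, forall i j, (0 < i <= j)%N -> (j <= n)%N ->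
    N i j = row_count m i j.
Proof.
move=> hr hd h0 hn.
have ge0 i j : (0 < i <= j)%N -> (j <= n)%N -> 0 <= N i j.
  move=> ij /subnK; move: (n - j)%N => d; elim: d i j ij => [|d IH] i j ij e.
    have jn : j = n by lia.
    by rewrite jn; apply: h0; rewrite -jn.
  apply: le_trans (hd _ _ ij _); last by lia.
  by apply: IH; lia.
have [|||m mE] := pattern_decode_nat (N := fun i j => absz (N i j)).
- by move=> i j ij jn; have := hr _ _ ij jn; have := ge0 i j ij (ltnW jn); lia.
- move=> i j ij jn; have := hd _ _ ij jn; have := ge0 i j ij (ltnW jn).
  have := ge0 i.+1 j.+1; lia.
- by rewrite hn.
exists m => i j ij jn; rewrite -mE // gez0_abs //; exact: ge0.
Qed.

End Patterns.

(** * The exponents [T_vector] and [GT_vector] in terms of row counts *)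

Section Entries.
Variable n : nat.
Local Notation V := (plucker_index n).

Lemma theta_indexP i j : (0 < i < j)%N -> (j <= n)%N ->
  exists p : theta_index n, [/\ (val p).1 = i :> nat, (val p).2 = j :> nat &
    forall (K : nmodType) (T : theta K n), entry T i j = T p].
Proof.
move=> /andP[i0 ij] jn; have hin : (i < n.+1)%N by lia.
have hp : (0 < (Ordinal hin, inord j : 'I_n.+1).1 < (Ordinal hin, inord j : 'I_n.+1).2)%N.
  by rewrite /= inordK // i0.
exists (Sub (Ordinal hin, inord j) hp); rewrite SubK /= inordK //; split=> // K T.
rewrite -entry_theta SubK /= inordK //.
Qed.

Lemma theta_index_bounds (p : theta_index n) :
  (0 < (val p).1 < (val p).2)%N /\ ((val p).2 <= n)%N.
Proof. by split; [exact: (valP p) | rewrite -ltnS ltn_ord]. Qed.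

Lemma entryMn (K : nmodType) (T : theta K n) k i j :
  entry (T *+ k) i j = entry T i j *+ k.
Proof. by rewrite /entry; case: insub => [p|]; rewrite ?ffunMnE ?mul0rn. Qed.

Lemma entry_real_point (R : realType) (m : theta int n) i j :
  entry (real_point R m : theta R n) i j = (entry m i j)%:~R.
Proof. by rewrite /entry; case: insub => [p|]; rewrite ?ffunE ?rmorph0. Qed.

(** The [i]-th index is [j] exactly when it is at most [j] and not at most [j - 1]; if [v] has fewer
    than [i] elements both terms are 0. *)
Lemma T_vectorE (v : V) (p : theta_index n) : T_vector v p =
  ((val p).1 <= cnt v (val p).2)%N%:Z - ((val p).1 <= cnt v (val p).2.-1)%N%:Z.
Proof.
have [/andP[i0 ij] jn] := theta_index_bounds p.
rewrite ffunE /= size_indices; move: i0 ij jn.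
move: (nat_of_ord (val p).1) (nat_of_ord (val p).2) => i j i0 ij jn.
have [iv|iv] := leqP i #|val v|; last first.
  have no k : (i <= cnt v k)%N = false.
    by apply/negbTE; rewrite -ltnNge (leq_ltn_trans (cnt_le_card v k)).
  by rewrite !no.
have ri : (i.-1 < #|val v|)%N by rewrite prednK.
pose r := Ordinal ri; rewrite (nth_indices r) /=.
have js : (j.-1 < n)%N by lia.
pose s := Ordinal js; have jE : j = s.+1 by rewrite /= prednK //; lia.
have -> : ((enum_val r).+1 == j) = (enum_val r == s) by rewrite jE eqSS.
have -> : cnt v j = (cnt v s + (s \in val v))%N by rewrite jE cntS.
have cr := cnt_enum_val r.
have [e|ne] := eqVneq (enum_val r) s.
  have -> : s \in val v by rewrite -e; exact: enum_valP.
  have cs : cnt v s = i.-1 by rewrite -e cr.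
  rewrite /= in cs; rewrite /= cs.
  lia.
have [sv|sv] := boolP (s \in val v); last by rewrite addn0 subrr.
have cs := cnt_enum_val (enum_rank_in sv s); rewrite enum_rankK_in // in cs.
have : cnt v j.-1 != i.-1.
  apply: contraNneq ne => h; have er : enum_rank_in sv s = r.
    by apply: val_inj; rewrite /= -h; exact: esym cs.
  by rewrite -er enum_rankK_in.
rewrite /=; case: (leqP i (cnt v j.-1)); lia.
Qed.

Lemma entry_wt_T (m : 'X_{1..#|V|}) i j : (0 < i < j)%N -> (j <= n)%N ->
  entry (wt (@T_vector n) m : theta int n) i j = row_count m i j - row_count m i j.-1.
Proof.
move=> ij jn; have [p [p1 p2 ->]] := theta_indexP ij jn.
rewrite wt_ffunE /row_count /wt -sumrB; apply: eq_bigr => v _.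
by rewrite T_vectorE p1 p2 -mulrnBl.
Qed.

Lemma sum_entry_wt_T (m : 'X_{1..#|V|}) i j : (0 < i <= j)%N -> (j <= n)%N ->
  \sum_(j.+1 <= l < n.+1) entry (wt (@T_vector n) m : theta int n) i l =
  row_count m i n - row_count m i j.
Proof.
move=> ij jn; rewrite -(telescope_sumr (row_count m i) jn) big_add1 /=.
by apply: eq_big_nat => l lj; rewrite entry_wt_T //; lia.
Qed.

(* Entry (i, j) of the Gelfand-Tsetlin pattern of a tableau counts the entries
   [<= n - j + i] of its row [i]. *)
Definition GT_vector (v : V) : theta int n :=
  [ffun p : theta_index n => ((val p).1 <= cnt v (n - (val p).2 + (val p).1))%N%:Z].

Lemma entry_wt_GT (m : 'X_{1..#|V|}) i j : (0 < i < j)%N -> (j <= n)%N ->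
  entry (wt GT_vector m : theta int n) i j = row_count m i (n - j + i).
Proof.
move=> ij jn; have [p [p1 p2 ->]] := theta_indexP ij jn.
rewrite wt_ffunE; apply: eq_bigr => v _.
by rewrite ffunE p1 p2.
Qed.

Lemma theta_ext (T T' : theta int n) :
  (forall i j, (0 < i < j)%N -> (j <= n)%N -> entry T i j = entry T' i j) -> T = T'.
Proof.
move=> h; apply/ffunP => p; have [p1 p2] := theta_index_bounds p.
by rewrite -!entry_theta h.
Qed.

End Entries.

(** * Lattice points of the dilated polytopes *)

Section LatticePoints.
Variables (n : nat) (a : nat -> int).
Hypothesis n_ge2 : (2 <= n)%N.
Hypothesis a_gt0 : forall k, (1 <= k <= n - 1)%N -> 0 < a k.
Local Notation V := (plucker_index n).
Local Notation deg := (fdeg (@fac (plucker_space n))).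
Implicit Types (c : 'X_{1..#|V|}) (m : theta int n).

Definition weight_deg (d : 'I_n.-1) : nat := absz (a d.+1).
(** The length of row [i] of a tableau with [a k] columns of length [k]. *)
Definition lambda (i : nat) : int := \sum_(i <= l < n) a l.

Lemma weight_deg_gt0 d : (0 < weight_deg d)%N.
Proof. by rewrite absz_gt0 gt_eqF // a_gt0 //; have := ltn_ord d; lia. Qed.

Lemma weight_degE (d : 'I_n.-1) : (weight_deg d)%:Z = a d.+1.
Proof. by rewrite gez0_abs // ltW // a_gt0 //; have := ltn_ord d; lia. Qed.

Lemma lambdaS i : (i < n)%N -> lambda i = a i + lambda i.+1.
Proof. by move=> h; rewrite /lambda big_ltn. Qed.

Lemma lambda_ge0 i : (0 < i)%N -> 0 <= lambda i.
Proof.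
move=> i0; rewrite /lambda big_nat sumr_ge0 // => l hl.
by rewrite ltW // a_gt0 //; lia.
Qed.

Lemma lambda_n : lambda n = 0.
Proof. by rewrite /lambda big_geq. Qed.

Lemma row_of_deg N c : (forall d, deg c d = N * weight_deg d)%N ->
  forall i, (0 < i <= n)%N -> row_count c i n = lambda i *+ N.
Proof.
move=> h i /andP[i0 /subnK]; move: (n - i)%N => d; elim: d i i0 => [|d IH] i i0 e.
  have -> : i = n by lia.
  by rewrite row_last lambda_n mul0rn.
case: i i0 e => // i _ e; have hi : (i < n.-1)%N by lia.
rewrite (row_deg _ hi) h IH; [|by [] | lia].
rewrite (lambdaS (i := i.+1)); last by lia.
rewrite mulrnDl; congr (_ + _).
by rewrite PoszM weight_degE mulrn_int mulrC.
Qed.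

Lemma deg_of_row N c : (forall i, (0 < i <= n)%N -> row_count c i n = lambda i *+ N) ->
  forall d, deg c d = (N * weight_deg d)%N.
Proof.
move=> h d; apply/eqP; rewrite -eqz_nat; apply/eqP.
have := ltn_ord d => hd.
rewrite deg_row !h; [|lia | lia].
rewrite (lambdaS (i := d.+1)); last by lia.
by rewrite mulrnDl addrK PoszM weight_degE mulrn_int mulrC.
Qed.

Lemma array_decode N (arr : nat -> nat -> int) :
  (forall i, (0 < i <= n)%N -> arr i n = lambda i *+ N) ->
  (forall i j, (0 < i <= j)%N -> (j < n)%N -> arr i j <= arr i j.+1) ->
  (forall i j, (0 < i <= j)%N -> (j < n)%N -> arr i.+1 j.+1 <= arr i j) ->
  exists2 c, (forall d, deg c d = N * weight_deg d)%N &
    forall i j, (0 < i <= j)%N -> (j <= n)%N -> arr i j = row_count c i j.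
Proof.
move=> hn hr hd.
have n0 : (0 < n)%N by lia.
have [||c cE] := pattern_decode n0 hr hd.
- by move=> i i0; rewrite hn // mulrn_wge0 // lambda_ge0 //; lia.
- by rewrite hn ?lambda_n ?mul0rn // n0 leqnn.
exists c => //; apply: deg_of_row => i hi; rewrite -cE ?hn //.
Qed.

(** The counts at [j = n] are the row lengths, which the multidegree already determines. *)
Lemma diag_exp_eq_row c c' : (forall d, deg c d = deg c' d) ->
  (forall i j, (0 < i <= j)%N -> (j < n)%N -> row_count c i j = row_count c' i j) ->
  wt (@diag_exp n) c = wt (@diag_exp n) c'.
Proof.
move=> hd h; apply/diag_exp_row => i j i0 jn.
case: (leqP i j) => ij; last by rewrite !row_big.
move: jn; rewrite leq_eqVlt => /predU1P[e|]; last by apply: h; rewrite ?i0.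
by subst j; apply: deg_eq_row => //; lia.
Qed.

(** The lattice points of the [N]-th dilate; scaling the right-hand sides instead of the points
    keeps the description over [int]. *)
Definition P_lattice (N : nat) m : Prop :=
  (forall i j, (1 <= i < j)%N -> (j <= n)%N -> 0 <= entry m i j) /\
  (forall i j, (1 <= i < j)%N -> (j <= n)%N ->
     \sum_(j <= l < n.+1) entry m i l - \sum_(j.+1 <= l < n.+1) entry m i.+1 l
       <= a i *+ N).

Lemma P_lattice_real (R : realType) m : P_polytope a (real_point R m) <-> P_lattice 1 m.
Proof.
have e i j : \sum_(j <= l < n.+1) entry (real_point R m : theta R n) i l =
    (\sum_(j <= l < n.+1) entry m i l)%:~R.
  by rewrite rmorph_sum; apply: eq_bigr => l _; rewrite entry_real_point.
split=> -[h1 h2]; split=> i j ij jn.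
- by have := h1 i j ij jn; rewrite entry_real_point ler0z.
- by have := h2 i j ij jn; rewrite !e -rmorphB ler_int.
- by rewrite entry_real_point ler0z h1.
- by rewrite !e -rmorphB ler_int h2.
Qed.

Lemma P_lattice_div N k m : (0 < k)%N -> P_lattice (k * N) (m *+ k) -> P_lattice N m.
Proof.
move=> k0 [h1 h2]; split=> i j ij jn.
  by have := h1 i j ij jn; rewrite entryMn pmulrn_lge0.
have e i' j' : \sum_(j' <= l < n.+1) entry (m *+ k : theta int n) i' l =
    (\sum_(j' <= l < n.+1) entry m i' l) *+ k.
  by rewrite -sumrMnl; apply: eq_bigr => l _; rewrite entryMn.
have := h2 i j ij jn; rewrite !e -mulrnBl mulnC mulrnA ler_pMn2r //.
Qed.

(** Tail sums of [T] are row lengths minus row counts. So [T >= 0] says that row counts increase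
    with [j], and the other inequalities become [row_count c i.+1 j.+1 <= row_count c i j]:
    together, the interlacing of a Gelfand-Tsetlin pattern. *)
Lemma P_lattice_wt N m : P_lattice N m <->
  exists2 c, (forall d, deg c d = N * weight_deg d)%N & m = wt (@T_vector n) c.
Proof.
split=> [[h1 h2]|[c hc ->]]; last first.
  have hr := row_of_deg hc.
  split=> i j ij jn.
    by rewrite entry_wt_T // subr_ge0; case: j ij jn => [|j] ij jn; [lia | exact: row_le_succ].
  case: j ij jn => [|j] ij jn; first by lia.
  rewrite sum_entry_wt_T; [|lia | lia].
  case: (leqP n j.+1) => [nj|nj].
    have jE : n = j.+1 by lia.
    rewrite big_geq; last by lia.
    have := row_succ_le c i j; rewrite -jE !hr; [|lia | lia].
    rewrite (lambdaS (i := i)); last by lia.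
    rewrite mulrnDl; lia.
  rewrite sum_entry_wt_T; [|lia | lia].
  have := row_succ_le c i j; rewrite !hr; [|lia | lia].
  rewrite (lambdaS (i := i)); last by lia.
  rewrite mulrnDl; lia.
pose arr i j := lambda i *+ N - \sum_(j.+1 <= l < n.+1) entry m i l.
have arr_n i : arr i n = lambda i *+ N by rewrite /arr big_geq // subr0.
have arrS i j : (j < n)%N -> arr i j.+1 = arr i j + entry m i j.+1.
  by move=> jn; rewrite /arr [in RHS]big_ltn // opprD addrA addrAC subrK.
have [|||c hc cE] := @array_decode N arr.
- by [].
- by move=> i j ij jn; rewrite arrS // lerDl h1 //; lia.
- move=> i j ij jn; have := h2 i j.+1 ij jn; rewrite /arr (lambdaS (i := i)); last by lia.
  rewrite mulrnDl; lia.
exists c => //; apply: theta_ext => i j ij jn; rewrite entry_wt_T //.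
case: j ij jn => [|j] ij jn; first by lia.
rewrite -!cE; try lia.
by rewrite arrS //= addrC addKr.
Qed.

Lemma P_weights c c' : (forall d, deg c d = deg c' d) ->
  wt (@diag_exp n) c = wt (@diag_exp n) c' <->
  wt (@T_vector n) c = wt (@T_vector n) c'.
Proof.
move=> hd; split=> [/diag_exp_row h|h].
  by apply: theta_ext => i j ij jn; rewrite !entry_wt_T // !h //; lia.
apply: diag_exp_eq_row => // i j ij jn.
have := sum_entry_wt_T c ij (ltnW jn); rewrite h sum_entry_wt_T //; last exact: ltnW.
rewrite (deg_eq_row hd); last by lia.
by move/addrI/oppr_inj.
Qed.

Definition GT_lattice (N : nat) m : Prop :=
  (forall i, (1 <= i <= n - 1)%N ->
     (entry m i i.+1 <= lambda i *+ N) /\ (lambda i.+1 *+ N <= entry m i i.+1)) /\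
  (forall i j, (1 <= i)%N -> (i.+1 < j)%N -> (j <= n)%N ->
     (entry m i j <= entry m i j.-1) /\ (entry m i.+1 j <= entry m i j)).

Lemma GT_lattice_real (R : realType) m : GT_polytope a (real_point R m) <-> GT_lattice 1 m.
Proof.
split=> -[h1 h2]; split=> [i hi|i j i0 ij jn].
- by have [] := h1 i hi; rewrite entry_real_point !ler_int.
- by have [] := h2 i j i0 ij jn; rewrite !entry_real_point !ler_int.
- by have [] := h1 i hi; rewrite entry_real_point !ler_int.
- by have [] := h2 i j i0 ij jn; rewrite !entry_real_point !ler_int.
Qed.

Lemma GT_lattice_div N k m : (0 < k)%N -> GT_lattice (k * N) (m *+ k) -> GT_lattice N m.
Proof.
move=> k0 [h1 h2]; split=> [i hi|i j i0 ij jn].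
  by have [] := h1 i hi; rewrite mulnC !mulrnA !entryMn !ler_pMn2r.
by have [] := h2 i j i0 ij jn; rewrite !entryMn !ler_pMn2r.
Qed.

(** For fixed [i] the map [j |-> n - j + i] is an order-reversing involution; it translates between
    the indexing of [GT_lattice] and that of row counts. *)
Lemma GT_lattice_wt N m : GT_lattice N m <->
  exists2 c, (forall d, deg c d = N * weight_deg d)%N & m = wt (@GT_vector n) c.
Proof.
split=> [[h1 h2]|[c hc ->]]; last first.
  have hr := row_of_deg hc.
  split=> [i hi|i j i0 ij jn].
    rewrite entry_wt_GT; [|lia | lia].
    have -> : (n - i.+1 + i)%N = n.-1 by lia.
    rewrite -!hr; [|lia | lia].
    have := row_le_succ c i n.-1; have := row_succ_le c i n.-1.
    by rewrite prednK //; lia.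
  rewrite !entry_wt_GT; try lia.
  have -> : (n - j.-1 + i)%N = (n - j + i).+1 by lia.
  by rewrite addnS row_le_succ row_succ_le.
(* The values at [j = n] are not coordinates of [theta]: they are the fixed boundary [lambda] of the
   Gelfand-Tsetlin pattern. *)
pose arr i j := if j == n then lambda i *+ N else entry m i (n - j + i).
have arr_n i : arr i n = lambda i *+ N by rewrite /arr eqxx.
have arr_lt i j : (j < n)%N -> arr i j = entry m i (n - j + i).
  by move=> jn; rewrite /arr ltn_eqF.
have [|||c hc cE] := @array_decode N arr.
- by [].
- move=> i j ij jn; rewrite [arr i j]arr_lt //.
  move: jn; rewrite leq_eqVlt => /predU1P[e|jn].
    rewrite e arr_n; have -> : (n - j + i)%N = i.+1 by lia.
    by have [|] := h1 i; first by lia.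
  rewrite arr_lt //; have -> : (n - j.+1 + i)%N = (n - j + i).-1 by lia.
  by have [|||] := h2 i (n - j + i)%N; try lia.
- move=> i j ij jn; rewrite [arr i j]arr_lt //.
  move: jn; rewrite leq_eqVlt => /predU1P[e|jn].
    rewrite e arr_n; have -> : (n - j + i)%N = i.+1 by lia.
    by have [|] := h1 i; first by lia.
  rewrite arr_lt //; have -> : (n - j.+1 + i.+1)%N = (n - j + i)%N by lia.
  by have [|||] := h2 i (n - j + i)%N; try lia.
exists c => //; apply: theta_ext => i j ij jn; rewrite entry_wt_GT //.
rewrite -cE; try lia.
rewrite arr_lt; last by lia.
congr (entry m i _); lia.
Qed.

Lemma GT_weights c c' : (forall d, deg c d = deg c' d) ->
  wt (@diag_exp n) c = wt (@diag_exp n) c' <->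
  wt (@GT_vector n) c = wt (@GT_vector n) c'.
Proof.
move=> hd; split=> [/diag_exp_row h|h].
  by apply: theta_ext => i j ij jn; rewrite !entry_wt_GT // !h //; lia.
apply: diag_exp_eq_row => // i j ij jn.
have e (c0 : 'X_{1..#|V|}) : row_count c0 i j = entry (wt (@GT_vector n) c0 : theta int n) i (n - j + i).
  by rewrite entry_wt_GT; [congr (row_count c0 i _); lia | lia | lia].
by rewrite !e h.
Qed.

End LatticePoints.

Theorem theorem3p9 (R : realType) (n : nat) (A : theta int n) (a : nat -> int)
  (n_ge2 : (2 <= n)%N)
  (A_a : forall i : nat, (1 <= i <= n - 2)%N ->
     entry A i i.+1 + entry A i.+1 i.+2 < entry A i i.+2)
  (A_b : forall i j : nat, (1 <= i)%N -> (i < j - 1)%N -> (j - 1 <= n - 2)%N ->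
     entry A i j + entry A i.+1 j.+1 < entry A i j.+1 + entry A i.+1 j)
  (a_regular : forall k : nat, (1 <= k <= n - 1)%N -> 0 < a k) :
  is_toric_variety_of (@P_polytope R n a)
    (degenerate_flag_ideal R[i] n (sigma A)) /\
  is_toric_variety_of (@GT_polytope R n a)
    (degenerate_flag_ideal R[i] n (sigma A)).
Proof.
have fac_surj (d : factor (plucker_space n)) :
    exists v : Defs.coord (plucker_space n), fac v = d.
  have hd : (0 < d.+1 < n)%N by have := ltn_ord d; lia.
  have dn : (d.+1 <= n)%N by lia.
  have winj : injective (widen_ord dn).
    by move=> x y /(congr1 val) e; apply: val_inj.
  have [v [_ vd _]] := plucker_of_seq winj hd.
  by exists v; apply: val_inj; rewrite /= vd.
have JE := degenerate_toricP n_ge2 A_a A_b.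
(* The isomorphism between the two toric varieties is expressed by comparing the one ideal with both
   polytopes. *)
split.
- apply: (toric_variety_criterion (QZ := @P_lattice n a) fac_surj
    (weight_deg_gt0 n_ge2 a_regular) (JE _) (@diag_exp_deg n) (P_weights n_ge2)).
  + exact: P_lattice_real.
  + exact: P_lattice_wt.
  + exact: P_lattice_div.
- apply: (toric_variety_criterion (QZ := @GT_lattice n a) fac_surj
    (weight_deg_gt0 n_ge2 a_regular) (JE _) (@diag_exp_deg n) (GT_weights n_ge2)).
  + exact: GT_lattice_real.
  + exact: GT_lattice_wt.
  + exact: GT_lattice_div.
Qed.
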